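(* Let $d>1$, let $H\in C^2(\mathbb{R}^d)$ be uniformly convex and not quadratic, and let $F(p):=\sqrt{D^2H(p)}$. Let $C>0$. (a) Suppose $u\in \mathrm{BUC}(\mathbb{R}^d\times[0,\infty))$ is a viscosity solution of $u_t=H(Du)$ in $\mathbb{R}^d\times(0,\infty)$ with $u(\cdot,0)\in C^{1,1}(\mathbb{R}^d)$ and $$-F(Du(\cdot,0))\,D^2u(\cdot,0)\,F(Du(\cdot,0))\ge -C\,I\quad\text{in }\mathbb{R}^d$$ in the viscosity sense. Then, for all $t>0$, in the viscosity sense, $$-F(Du(\cdot,t))\,D^2u(\cdot,t)\,F(Du(\cdot,t))\ge -\frac{C}{(1-Ct)_+}\,I\quad\text{in }\mathbb{R}^d.$$ (b) Suppose $u\in \mathrm{BUC}(\mathbb{R}^d\times[0,\infty))$ is a viscosity solution of $u_t=-H(Du)$ in $\mathbb{R}^d\times(0,\infty)$ with $u(\cdot,0)\in C^{1,1}(\mathbb{R}^d)$ and $$-F(Du(\cdot,0))\,D^2u(\cdot,0)\,F(Du(\cdot,0))\le C\,I\quad\text{in }\mathbb{R}^d$$ in the viscosity sense. Then, for all $t>0$, in the viscosity sense, $$-F(Du(\cdot,t))\,D^2u(\cdot,t)\,F(Du(\cdot,t))\le \frac{C}{(1-Ct)_+}\,I\quad\text{in }\mathbb{R}^d.$$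
   Context: $\mathrm{BUC}(X)$ is the set of bounded uniformly continuous real functions on $X$; $C^{1,1}(\mathbb{R}^d)$ is the set of differentiable functions on $\mathbb{R}^d$ with (globally) Lipschitz continuous gradient. $I$ is the $d\times d$ identity matrix, and matrix inequalities are in the sense of symmetric matrices. ''$H\in C^2(\mathbb{R}^d)$ is uniformly convex'' means that there exist $\Theta,\theta>0$ such that $\theta I\le D^2H(p)\le\Theta I$ for all $p\in\mathbb{R}^d$. $F(p)=\sqrt{D^2H(p)}$ is the positive definite symmetric square root. $H$ is called quadratic if there exists a symmetric matrix $A$ with $\theta I\le A\le\Theta I$ for some $\theta,\Theta>0$ such that $H(p)=(Ap,p)$ for all $p$. Solutions of $u_t=\pm H(Du)$ are Crandall-Lions viscosity solutions. For a continuous $v:\mathbb{R}^d\to\mathbb{R}$ and a constant $K$, the inequality $-F(Dv)D^2vF(Dv)\le K I$ (resp. $\ge -KI$) holds in the viscosity sense if, for every smooth $\phi$ and every maximum (resp. minimum) point $x_0$ of $v-\phi$, $-F(D\phi(x_0))D^2\phi(x_0)F(D\phi(x_0))\le K I$ (resp. $\ge -KI$). $s_+=\max(s,0)$, and when $(1-Ct)_+=0$ the quotient $\frac{C}{(1-Ct)_+}$ is $+\infty$, so the inequality is void. *)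

(* Defs.v *)
From mathcomp Require Import all_boot all_order all_algebra.
From mathcomp Require Import all_classical all_reals all_analysis.

Set Implicit Arguments.
Unset Strict Implicit.
Unset Printing Implicit Defensive.

Import Order.TTheory GRing.Theory Num.Theory.
Import numFieldNormedType.Exports.

Local Open Scope classical_set_scope.
Local Open Scope ring_scope.

(* Points of R^d are row vectors.  Their norm in the library is the sup norm;
   uniform continuity and Lipschitz continuity do not depend on the choice of
   the norm. *)

Section Differentiability.
Context {R : realType}.

(* [Ck_on A k f]: f is of class C^k on the open set A.  All directional
   derivatives up to order k exist and are continuous on A, which is the usual
   notion when V is finite-dimensional. *)
Fixpoint Ck_on {V : normedModType R} (A : set V) (k : nat) (f : V -> R) : Prop :=
  (forall x, A x -> {for x, continuous f}) /\
  match k with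
  | 0 => True
  | k'.+1 => forall v, (forall x, A x -> derivable f x v) /\ Ck_on A k' ('D_v f)
  end.

Definition smooth {V : normedModType R} (f : V -> R) : Prop :=
  forall k, Ck_on [set: V] k f.

Context {d : nat}.
Implicit Types (f : 'rV[R]_d -> R) (x : 'rV[R]_d).

Definition grad f x : 'rV[R]_d := \row_i 'D_(delta_mx 0 i) f x.

Definition hess f x : 'M[R]_d :=
  \matrix_(i, j) 'D_(delta_mx 0 i) ('D_(delta_mx 0 j) f) x.

Definition C11 f : Prop :=
  (forall x, differentiable f x) /\ lipschitz (grad f).

End Differentiability.

Section SymmetricMatrices.
Context {R : realType} {d : nat}.
Implicit Types A B : 'M[R]_d.

Definition inner (x y : 'rV[R]_d) : R := (x *m y^T) 0 0.

Definition loewner_le A B : Prop :=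
  forall v : 'rV[R]_d, inner (v *m A) v <= inner (v *m B) v.

Definition symmetric_posdef A : Prop :=
  A^T = A /\ forall v : 'rV[R]_d, v != 0 -> 0 < inner (v *m A) v.

(* The positive definite symmetric square root; it exists and is unique when A
   is symmetric positive definite, and is an arbitrary matrix when no such root
   exists. *)
Definition sqrtmx A : 'M[R]_d :=
  get [set B | symmetric_posdef B /\ B *m B = A].

End SymmetricMatrices.

Section Hamiltonian.
Context {R : realType} {d : nat}.
Implicit Type H : 'rV[R]_d -> R.

Definition uniformly_convex H : Prop :=
  exists Theta theta : R, [/\ 0 < Theta, 0 < theta &
    forall p, loewner_le theta%:M (hess H p) /\ loewner_le (hess H p) Theta%:M].

Definition quadratic H : Prop :=
  exists A : 'M[R]_d,
    [/\ A^T = A,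
        exists theta Theta : R, [/\ 0 < theta, 0 < Theta,
          loewner_le theta%:M A & loewner_le A Theta%:M] &
        forall p, H p = inner (p *m A) p].

End Hamiltonian.

Section Viscosity.
Context {R : realType} {d : nat}.

(* Space-time points are pairs (x, t) : 'rV[R]_d * R; a function on
   R^d x [0, oo) is a total function whose values at t < 0 are never used. *)
Definition closed_half_space : set ('rV[R]_d * R) := [set z | 0 <= z.2].
Definition open_half_space : set ('rV[R]_d * R) := [set z | 0 < z.2].

Definition BUC_on {V : normedModType R} (A : set V) (f : V -> R) : Prop :=
  [bounded f z | z in A] /\ unif_continuous (f : subspace A -> R).

Implicit Types (u phi : 'rV[R]_d * R -> R) (G : 'rV[R]_d -> R).

Definition time_derivative phi (z : 'rV[R]_d * R) : R :=
  derive1 (fun t : R => phi (z.1, t)) z.2.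

Definition space_grad phi (z : 'rV[R]_d * R) : 'rV[R]_d :=
  grad (fun x => phi (x, z.2)) z.1.

(* Crandall-Lions sub- and supersolutions of u_t = G(Du) in R^d x (0, oo). *)
Definition viscosity_subsolution G u : Prop :=
  forall phi, Ck_on open_half_space 1 phi ->
  forall z, open_half_space z ->
    (\forall w \near z, u w - phi w <= u z - phi z) ->
    time_derivative phi z <= G (space_grad phi z).

Definition viscosity_supersolution G u : Prop :=
  forall phi, Ck_on open_half_space 1 phi ->
  forall z, open_half_space z ->
    (\forall w \near z, u z - phi z <= u w - phi w) ->
    G (space_grad phi z) <= time_derivative phi z.

Definition viscosity_solution G u : Prop :=
  [/\ forall z, open_half_space z -> {for z, continuous u},
      viscosity_subsolution G u & viscosity_supersolution G u].

Implicit Types (F : 'rV[R]_d -> 'M[R]_d) (v : 'rV[R]_d -> R).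

(* -F(Dv) D^2v F(Dv) <= K I and -F(Dv) D^2v F(Dv) >= -K I in R^d, in the
   viscosity sense. *)
Definition viscosity_le F v (K : R) : Prop :=
  forall phi : 'rV[R]_d -> R, smooth phi ->
  forall x0, (forall x, v x - phi x <= v x0 - phi x0) ->
    loewner_le
      (- (F (grad phi x0) *m hess phi x0 *m F (grad phi x0))) K%:M.

Definition viscosity_ge F v (K : R) : Prop :=
  forall phi : 'rV[R]_d -> R, smooth phi ->
  forall x0, (forall x, v x0 - phi x0 <= v x - phi x) ->
    loewner_le
      (- K)%:M (- (F (grad phi x0) *m hess phi x0 *m F (grad phi x0))).

End Viscosity.

(* Main.v *)
Require Import Defs.
From mathcomp Require Import all_boot all_order all_algebra.
From mathcomp Require Import all_classical all_reals all_analysis.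
From mathcomp Require Import ring lra.
From mathcomp Require Import complex.

(** The equation [u_t = H (Du)] transports slopes along the characteristics
    [x' = - DH (p)] with [p] constant, and along them the Hessian [M] of [u] obeys the
    Riccati equation [M' = M A M] with [A = D^2 H (p)], that is
    [(M^-1)' = - A]. With [F = sqrt A], the bound [F M F <= K I] means [M <= K A^-1]; a
    bound [M <= C A^-1] at time 0 therefore becomes [M <= C / (1 - C t) A^-1] at
    time [t], because [M^-1] loses exactly [t A]. The proof makes this
    computation rigorous with one-sided second-order expansions of [u].

    First, for data with Lipschitz gradient, the viscosity inequality at time 0
    implies an upper expansion of second order at every point, with the quadratic
    form [C A(Du)^-1] ([hessian_le_of_touching]); a global semiconcavity
    bound follows ([semiconcave_of_hessian_le]).

    Second, when the slopes are [k]-Lipschitz the characteristics do not cross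
    for a time depending on [H] and [k] only, so they define a function which
    satisfies the equation in the classical sense. The identity
    [characteristic_identity] shows that its gradient is the transported slope, with a
    quadratic remainder. A viscosity solution with the same data coincides
    with it ([comparison], used in both directions in [solution_eq_transported]).

    Third, over one such step semiconvexity is preserved, by the Hopf-Lax
    inequality [transported_ge], and the upper expansion evolves by the
    Riccati law: inserting the expansions of the data and of [H] in the same identity
    leaves the algebraic inequality [riccati_le], which is a completed square
    ([transported_hessian_le]). Both bounds on the Hessian stay uniform up to time [t]
    when [C t < 1], so the step length does too and finitely many steps suffice
    ([inverse_hessian_bound_propagates]).

    At time [t] the upper expansion gives the viscosity inequality back. The
    equation [u_t = - H (Du)] reduces to the other one by replacing [u] by [- u] and
    [H (p)] by [H (- p)]. *)

Set Implicit Arguments.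
Unset Strict Implicit.
Unset Printing Implicit Defensive.

Import Order.TTheory GRing.Theory Num.Theory.
Import numFieldNormedType.Exports.

Local Open Scope classical_set_scope.
Local Open Scope ring_scope.

(** * Euclidean geometry of row vectors *)

Section InnerProduct.
Context {R : realType} {d : nat}.
Implicit Types (x y z : 'rV[R]_d) (A : 'M[R]_d) (c : R).

Definition sqnorm x : R := inner x x.

Lemma inner_sumE x y : inner x y = \sum_i x 0 i * y 0 i.
Proof. by rewrite /inner mxE; apply: eq_bigr => i _; rewrite mxE. Qed.

Lemma innerC x y : inner x y = inner y x.
Proof. by rewrite !inner_sumE; apply: eq_bigr => i _; rewrite mulrC. Qed.

Lemma innerDl x y z : inner (x + y) z = inner x z + inner y z.
Proof. by rewrite /inner mulmxDl mxE. Qed.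

Lemma innerDr x y z : inner z (x + y) = inner z x + inner z y.
Proof. by rewrite innerC innerDl !(innerC z). Qed.

Lemma innerZl c x y : inner (c *: x) y = c * inner x y.
Proof. by rewrite /inner -scalemxAl mxE. Qed.

Lemma innerZr c x y : inner x (c *: y) = c * inner x y.
Proof. by rewrite innerC innerZl innerC. Qed.

Lemma innerNl x y : inner (- x) y = - inner x y.
Proof. by rewrite /inner mulNmx mxE. Qed.

Lemma innerNr x y : inner x (- y) = - inner x y.
Proof. by rewrite innerC innerNl innerC. Qed.

Lemma inner0l x : inner 0 x = 0.
Proof. by rewrite /inner mul0mx mxE. Qed.

Lemma inner0r x : inner x 0 = 0.
Proof. by rewrite innerC inner0l. Qed.

Definition inner_lin :=
  (innerDl, innerDr, innerNl, innerNr, innerZl, innerZr, inner0l, inner0r).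

Lemma inner_mulmx x A y : inner (x *m A) y = inner x (y *m A^T).
Proof. by rewrite /inner trmx_mul trmxK mulmxA. Qed.

Lemma inner_scalar_mx c x y : inner (x *m c%:M) y = c * inner x y.
Proof. by rewrite mul_mx_scalar innerZl. Qed.

Lemma inner_quad_sumE A x y :
  inner (x *m A) y = \sum_i \sum_j x 0 i * A i j * y 0 j.
Proof.
rewrite inner_sumE exchange_big /=; apply: eq_bigr => j _.
by rewrite mxE mulr_suml; apply: eq_bigr.
Qed.

Lemma inner_delta x i : inner x (delta_mx 0 i) = x 0 i.
Proof.
rewrite inner_sumE (bigD1 i) //= big1 ?addr0 ?mxE ?eqxx ?mulr1 // => j jNi.
by rewrite mxE (negbTE jNi) andbF mulr0.
Qed.

Lemma sqnorm_ge0 x : 0 <= sqnorm x.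
Proof.
by rewrite /sqnorm inner_sumE; apply: sumr_ge0 => i _; rewrite -expr2 sqr_ge0.
Qed.

Lemma sqnorm_eq0 x : (sqnorm x == 0) = (x == 0).
Proof.
apply/eqP/eqP => [|->]; last by rewrite /sqnorm inner0l.
rewrite /sqnorm inner_sumE => /eqP; rewrite psumr_eq0; last first.
  by move=> i _; rewrite -expr2 sqr_ge0.
move=> /allP x0; apply/matrixP => i j; rewrite ord1 mxE.
have /eqP := x0 j (mem_index_enum _).
by move/eqP; rewrite mulf_eq0 orbb => /eqP.
Qed.

Lemma sqnorm_gt0 x : (0 < sqnorm x) = (x != 0).
Proof. by rewrite lt_neqAle sqnorm_ge0 andbT eq_sym sqnorm_eq0. Qed.

Lemma sqnorm0 : sqnorm 0 = 0.
Proof. by rewrite /sqnorm inner0l. Qed.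

Lemma sqnormN x : sqnorm (- x) = sqnorm x.
Proof. by rewrite /sqnorm !inner_lin opprK. Qed.

Lemma sqnormZ c x : sqnorm (c *: x) = c ^+ 2 * sqnorm x.
Proof. by rewrite /sqnorm !inner_lin mulrA expr2. Qed.

Lemma sqnormD x y : sqnorm (x + y) = sqnorm x + 2 * inner x y + sqnorm y.
Proof. by rewrite /sqnorm !inner_lin (innerC y x); ring. Qed.

Lemma sqnormB x y : sqnorm (x - y) = sqnorm x - 2 * inner x y + sqnorm y.
Proof. by rewrite sqnormD innerNr sqnormN; ring. Qed.

(** Young's inequality; used in place of Cauchy-Schwarz it keeps most estimates
    below linear in squared norms. *)
Lemma inner_young c x y :
  0 < c -> 2 * inner x y <= c * sqnorm x + c^-1 * sqnorm y.
Proof.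
move=> c0; have := sqnorm_ge0 (c *: x - y).
rewrite sqnormB sqnormZ innerZl => h.
rewrite -(ler_pM2l c0) mulrDr (mulrA c c^-1) divff ?gt_eqF // mul1r.
by move: h; rewrite expr2; lra.
Qed.

Lemma cauchy_schwarz x y : inner x y ^+ 2 <= sqnorm x * sqnorm y.
Proof.
have [->|y0] := eqVneq y 0; first by rewrite inner0r sqnorm0 mulr0 expr0n.
have y_gt0 : 0 < sqnorm y by rewrite sqnorm_gt0.
have := sqnorm_ge0 (sqnorm y *: x - inner x y *: y).
rewrite sqnormB !sqnormZ innerZl innerZr => h.
rewrite -(ler_pM2l y_gt0); move: h; rewrite !expr2; lra.
Qed.

Lemma sqnormD_le x y : sqnorm (x + y) <= 2 * sqnorm x + 2 * sqnorm y.
Proof.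
by rewrite sqnormD; have := inner_young x y ltr01; rewrite invr1; lra.
Qed.

Lemma sqnorm_le_norm x : sqnorm x <= d%:R * `|x| ^+ 2.
Proof.
rewrite /sqnorm inner_sumE mulr_natl -[X in _ *+ X]card_ord -sumr_const.
apply: ler_sum => i _; rewrite -expr2 -real_normK ?num_real //.
rewrite lerXn2r ?nnegrE // [leRHS]/Num.norm /= mx_normrE.
by apply/bigmax_geP; right => /=; exists (0, i).
Qed.

Lemma sqnormD3_le x y z :
  sqnorm (x + (y + z)) <= 3 * sqnorm x + 3 * sqnorm y + 3 * sqnorm z.
Proof.
rewrite !sqnormD !innerDr.
have := inner_young x y ltr01; have := inner_young x z ltr01.
by have := inner_young y z ltr01; rewrite invr1; lra.
Qed.

Lemma sqr_coord_le x i : x 0 i ^+ 2 <= sqnorm x.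
Proof.
rewrite /sqnorm inner_sumE (bigD1 i) //= -expr2 lerDl.
by apply: sumr_ge0 => k _; rewrite -expr2 sqr_ge0.
Qed.

Lemma norm_le_sqnorm x : `|x| ^+ 2 <= sqnorm x.
Proof.
rewrite -[leRHS]sqr_sqrtr ?sqnorm_ge0 // lerXn2r ?nnegrE ?sqrtr_ge0 //.
rewrite [leLHS]/Num.norm /= mx_normrE; apply/bigmax_leP; split.
  exact: sqrtr_ge0.
move=> [i j] _ /=; rewrite ord1 -sqrtr_sqr ler_wsqrtr //.
exact: sqr_coord_le.
Qed.

Definition mxsum A : R := \sum_i \sum_j `|A i j|.

Lemma mxsum_ge0 A : 0 <= mxsum A.
Proof. by apply: sumr_ge0 => i _; apply: sumr_ge0. Qed.

Lemma inner_mulmx_le A x y :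
  inner (x *m A) y <= mxsum A * ((sqnorm x + sqnorm y) / 2).
Proof.
rewrite inner_quad_sumE mulr_suml; apply: ler_sum => i _.
rewrite mulr_suml; apply: ler_sum => j _.
apply: (@le_trans _ _ (`|A i j| * (`|x 0 i| * `|y 0 j|))).
  apply: le_trans (ler_norm _) _; rewrite !normrM.
  by rewrite (mulrC `|x 0 i|) mulrA.
apply: ler_wpM2l => //.
have := sqr_ge0 (`|x 0 i| - `|y 0 j|); rewrite sqrrB !real_normK ?num_real //.
by have := sqr_coord_le x i; have := sqr_coord_le y j; rewrite mulr2n; lra.
Qed.

Lemma sqnorm_mulmx_le A x : sqnorm (x *m A) <= mxsum A ^+ 2 * sqnorm x.
Proof.
have := mxsum_ge0 A; rewrite le_eqVlt => /predU1P[b0|b0].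
  have := inner_mulmx_le A x (x *m A); rewrite -b0 mul0r => h.
  by rewrite expr0n /= mul0r.
have := inner_mulmx_le A x ((mxsum A)^-1 *: (x *m A)).
rewrite innerZr -/(sqnorm _) sqnormZ exprVn.
set b := mxsum A in b0 *; set w := sqnorm _; set z := sqnorm x => h.
have : 2 * b * (b^-1 * w) <= 2 * b * (b * ((z + (b ^+ 2)^-1 * w) / 2)).
  by rewrite ler_pM2l; lra.
have -> : 2 * b * (b^-1 * w) = 2 * w by field; rewrite gt_eqF.
have -> : 2 * b * (b * ((z + (b ^+ 2)^-1 * w) / 2)) = b ^+ 2 * z + w.
  by field; rewrite gt_eqF.
by lra.
Qed.

Lemma quad_form_ge A x : - (mxsum A * sqnorm x) <= inner (x *m A) x.
Proof.
rewrite lerNl -innerNr; apply: le_trans (inner_mulmx_le _ _ _) _.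
by rewrite sqnormN; lra.
Qed.

(** The topology comes from the sup norm; this is the passage to Euclidean
    balls, in which the expansions below are stated. *)
Lemma nbhs_sqnormP x (P : set 'rV[R]_d) :
  nbhs x P <-> exists2 r, 0 < r & forall e, sqnorm e < r -> P (x + e).
Proof.
split=> [/nbhs_ballP[r /= r0 xP]|[r r0 xP]].
  exists (r ^+ 2); first by rewrite exprn_gt0.
  move=> e er; apply: xP; rewrite -ball_normE /= opprD addrA subrr sub0r normrN.
  have := le_lt_trans (norm_le_sqnorm e) er.
  by rewrite ltr_pXn2r // nnegrE ?normr_ge0 ?ltW.
apply/nbhs_ballP.
have s0 : 0 < r / (d%:R + 1) by rewrite divr_gt0 // ltr_wpDl.
exists (Num.sqrt (r / (d%:R + 1))); first by rewrite /= sqrtr_gt0.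
move=> y; rewrite -ball_normE /= => xy.
rewrite -[y](subrK x) addrC; apply: xP.
have := sqnorm_le_norm (y - x); rewrite distrC => /le_lt_trans; apply.
move: xy; have := normr_ge0 (x - y); set n := `|_| => n0 xy.
have : n ^+ 2 < r / (d%:R + 1).
  by rewrite -[ltRHS]sqr_sqrtr ?ltW // ltr_pXn2r // nnegrE ?sqrtr_ge0.
rewrite ltr_pdivlMr ?ltr_wpDl // mulrC => /(le_lt_trans _); apply.
by apply: ler_wpM2r; rewrite ?exprn_ge0 // lerDl.
Qed.

End InnerProduct.

(** * Pointwise operations on continuous real functions *)

(** Stated for explicit lambda terms, so that they apply by unification to
    compound expressions. *)
Section PointwiseContinuity.
Context {R : realType} {T : topologicalType}.
Implicit Types (f g : T -> R) (x : T).

Lemma continuous_at_cst (c : R) x : continuous_at x (fun=> c).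
Proof. exact: cvg_cst. Qed.

Lemma continuous_atD f g x : continuous_at x f -> continuous_at x g ->
  continuous_at x (fun z => f z + g z).
Proof. exact: continuousD. Qed.

Lemma continuous_atN f x : continuous_at x f -> continuous_at x (fun z => - f z).
Proof. exact: continuousN. Qed.

Lemma continuous_atB f g x : continuous_at x f -> continuous_at x g ->
  continuous_at x (fun z => f z - g z).
Proof. exact: continuousB. Qed.

Lemma continuous_atM f g x : continuous_at x f -> continuous_at x g ->
  continuous_at x (fun z => f z * g z).
Proof. exact: continuousM. Qed.

Lemma continuous_at_sqr f x : continuous_at x f ->
  continuous_at x (fun z => f z ^+ 2).
Proof. by move=> cf; exact: continuous_atM. Qed.

Lemma near_lt_of_continuous f x c : continuous_at x f -> f x < c -> \forall z \near x, f z < c.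
Proof. by move=> cf fxc; exact: (@cvgr_lt R T (nbhs x) _ f (f x) cf c fxc). Qed.

Lemma near_gt_of_continuous f x c : continuous_at x f -> c < f x -> \forall z \near x, c < f z.
Proof. by move=> cf fxc; exact: (@cvgr_gt R T (nbhs x) _ f (f x) cf c fxc). Qed.

End PointwiseContinuity.

(** * Second-order bounds along a field of slopes *)

Section SecondOrderBounds.
Context {R : realType} {d : nat}.
Implicit Types (v : 'rV[R]_d -> R) (G : 'rV[R]_d -> 'rV[R]_d) (e x y : 'rV[R]_d).

Lemma inner_continuous a : continuous (fun z : 'rV[R]_d => inner z a).
Proof.
under eq_fun do rewrite inner_sumE.
apply: continuous_big => [|i _ z]; first exact: add_continuous.
exact: (cvgMr_tmp (@coord_continuous R 1 d 0 i z)).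
Qed.

Lemma inner_continuousr a : continuous (fun z : 'rV[R]_d => inner a z).
Proof.
have -> : inner a = (fun z => inner z a) by apply/funext => z; exact: innerC.
exact: inner_continuous.
Qed.

Lemma sqnorm_continuous : continuous (@sqnorm R d).
Proof.
rewrite /sqnorm; under eq_fun do rewrite inner_sumE.
apply: continuous_big => [|i _ z]; first exact: add_continuous.
have h := @coord_continuous R 1 d 0 i z; exact: (cvgM h h).
Qed.

Lemma closed_sublevel (T : topologicalType) (f : T -> R) (c : R) :
  continuous f -> closed [set z | f z <= c].
Proof.
move=> cf; apply: (@preimage_closed _ _ f [set r | r <= c]); last exact: closed_le.
by move=> z _; exact: cf.
Qed.

Lemma compact_sqnorm_le (A : set 'rV[R]_d) (M : R) :
  closed A -> (forall x, A x -> sqnorm x <= M) -> compact A.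
Proof.
move=> Acl AM; apply: bounded_closed_compact => //.
exists (Num.sqrt M); split=> [|r Mr x /AM xM]; first exact: num_real.
apply: le_trans _ (ltW Mr).
rewrite -(ger0_norm (normr_ge0 x)) -sqrtr_sqr ler_wsqrtr //.
exact: le_trans (norm_le_sqnorm x) xM.
Qed.

Lemma translate_continuous x : continuous (fun e : 'rV[R]_d => x + e).
Proof.
move=> z A /nbhs_sqnormP [r r0 xA]; apply/nbhs_sqnormP; exists r => // e er.
by rewrite /preimage /= addrA; exact: xA.
Qed.

Lemma line_continuous x e : continuous (fun s : R => x + s *: e).
Proof.
move=> t; have h : s *: e @[s --> t] --> t *: e by apply: cvgZr_tmp.
exact: (cvgD (cvg_cst x) h).
Qed.

Lemma exists_small_scale (c n r : R) : 0 < c -> 0 <= n -> 0 < r ->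
  exists2 s, 0 < s <= c & s ^+ 2 * n < r.
Proof.
move=> c0 n0 r0; exists (Num.min c (Num.min 1 (r / (n + 1)))).
  by rewrite lt_min c0 lt_min ltr01 divr_gt0 ?ltr_wpDl //= ge_min lexx.
set s := Num.min _ _.
have s0 : 0 < s by rewrite lt_min c0 lt_min ltr01 divr_gt0 ?ltr_wpDl.
have s1 : s <= 1 by rewrite !ge_min lexx !orbT.
have : s <= r / (n + 1) by rewrite !ge_min lexx !orbT.
rewrite ler_pdivlMr ?ltr_wpDl // => sn; rewrite expr2.
have : s * (s * (n + 1)) <= s * r by rewrite ler_pM2l.
nra.
Qed.

(** The slope [G y] plays the part of the gradient of [v] at [y]. Carrying it as
    data makes it possible to propagate these bounds in time without
    differentiating the solution. *)
Definition semiconvex_along v G (k : R) :=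
  forall y e, v y + inner (G y) e - k / 2 * sqnorm e <= v (y + e).

Definition semiconcave_along v G (k : R) :=
  forall y e, v (y + e) <= v y + inner (G y) e + k / 2 * sqnorm e.

(** The pointwise form of [D^2 v <= N (Dv)]: the quadratic form [N] depends on the
    slope only, as the inverse Hessian of the Hamiltonian does. *)
Definition hessian_le v G (N : 'rV[R]_d -> 'rV[R]_d -> R) :=
  forall y eps, 0 < eps -> exists2 r, 0 < r & forall e, sqnorm e < r ->
    v (y + e) <= v y + inner (G y) e + N (G y) e / 2 + eps * sqnorm e.

(** On a segment where the bound failed, subtracting a slightly steeper parabola
    and a small linear term produces an interior minimum. Adding the local upper
    bound at that minimum, taken in the two opposite directions, contradicts
    minimality. *)
Lemma semiconcave_of_hessian_le v G N k : continuous v ->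
  hessian_le v G N -> (forall p e, N p e <= k * sqnorm e) ->
  semiconcave_along v G k.
Proof.
move=> cv vN Nk y e; rewrite leNgt; apply/negP => gap.
pose g1 := v (y + e) - v y - inner (G y) e - k / 2 * sqnorm e.
have g10 : 0 < g1 by rewrite /g1; lra.
have n0 : 0 < sqnorm e.
  rewrite sqnorm_gt0; apply/negP => /eqP e0; move: gap.
  by rewrite e0 addr0 inner0r sqnorm0 mulr0 !addr0 ltxx.
set n := sqnorm e in n0 g1 g10 gap *.
pose eps := g1 / (4 * n).
have eps0 : 0 < eps by rewrite divr_gt0 // mulr_gt0.
have epsn : eps * n = g1 / 4 by rewrite /eps; field; rewrite gt_eqF.
pose mu := g1 / 4.
have mu0 : 0 < mu by rewrite /mu; lra.
pose m t := v (y + t *: e) - v y - t * inner (G y) e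
            - t ^+ 2 * ((k / 2 + eps) * n) - mu * t.
have cm : continuous m.
  move=> t; have cid : {for t, continuous (id : R -> R)} by [].
  have cve : {for t, continuous (fun s : R => v (y + s *: e))}.
    apply: (@continuous_comp _ _ _ (fun s : R => y + s *: e) v); last exact: cv.
    exact: line_continuous.
  rewrite /m; do 4 ?apply: continuous_atB => //; try exact: continuous_at_cst.
  - by apply: continuous_atM => //; exact: continuous_at_cst.
  - by apply: continuous_atM; [exact: continuous_at_sqr|exact: continuous_at_cst].
  - by apply: continuous_atM => //; exact: continuous_at_cst.
have m0 : m 0 = 0 by rewrite /m scale0r addr0; ring.
have m1 : 0 < m 1.
  rewrite /m scale1r mulrDl epsn /mu; move: g10; rewrite /g1; lra.
have quad z (r eta : R) : 0 < eta ->
    (forall e', sqnorm e' < r -> v (z + e') <= v z + inner (G z) e'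
        + N (G z) e' / 2 + eta * sqnorm e') ->
    forall s, s ^+ 2 * n < r -> v (z + s *: e) <= v z + s * inner (G z) e
        + s ^+ 2 * ((k / 2 + eta) * n).
  move=> eta0 hr s sr; have := hr (s *: e); rewrite sqnormZ => /(_ sr).
  rewrite innerZr; have := Nk (G z) (s *: e); rewrite sqnormZ -/n.
  by lra.
have [t0 t0I t0min] := EVT_min ler01 (continuous_subspaceT cm).
have mt0 : m t0 < 0.
  have [r r0 hr] := vN y eps eps0.
  have [s /andP[s0 s1] sr] := exists_small_scale ltr01 (ltW n0) r0.
  apply: le_lt_trans (t0min s _) _; first by rewrite in_itv /= ltW.
  have := quad _ _ _ eps0 hr _ sr; rewrite /m.
  have : 0 < mu * s by rewrite mulr_gt0.
  by lra.
have {t0I} /andP[t00 t01] : 0 < t0 < 1.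
  move: t0I; rewrite in_itv /= !le_eqVlt => /andP[/predU1P[t00|->]].
    by move: mt0; rewrite -t00 m0 ltxx.
  by case/predU1P => // t01; move: mt0; rewrite t01 => /(lt_trans m1); rewrite ltxx.
have [r r0 hr] := vN (y + t0 *: e) (eps / 2) (divr_gt0 eps0 (ltr0Sn _ 1)).
have c0 : 0 < Num.min t0 (1 - t0) by rewrite lt_min t00 subr_gt0.
have [s /andP[s0]] := exists_small_scale c0 (ltW n0) r0.
rewrite le_min => /andP[st0 st1] sr.
have hs := quad _ _ _ (divr_gt0 eps0 (ltr0Sn _ 1)) hr.
have h1 := hs s sr; have h2 := hs (- s); rewrite sqrrN in h2; have {}h2 := h2 sr.
have : m t0 <= m (t0 + s) by apply: t0min; rewrite in_itv /=; apply/andP; split; lra.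
have : m t0 <= m (t0 - s) by apply: t0min; rewrite in_itv /=; apply/andP; split; lra.
have shift z : y + t0 *: e + z *: e = y + (t0 + z) *: e by rewrite scalerDl addrA.
move: h1 h2; rewrite !shift /m.
set a := v (y + (t0 + s) *: e); set b := v (y + (t0 - s) *: e).
set c := v (y + t0 *: e); set u := inner (G (y + _)) e; set w := inner (G y) e.
move=> h1 h2 h3 h4.
have : 0 < s ^+ 2 * (eps * n) by apply: mulr_gt0; [exact: exprn_gt0|exact: mulr_gt0].
by move: h1 h2 h3 h4; rewrite !expr2; lra.
Qed.

(** Compare [v] at [x + e] as seen from [x] and as seen from [y], then choose [e]
    proportional to the difference of the slopes. *)
Lemma field_lipschitz v G k : 0 < k ->
  semiconvex_along v G k -> semiconcave_along v G k ->
  forall x y, sqnorm (G x - G y) <= 9 * k ^+ 2 * sqnorm (x - y).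
Proof.
move=> k0 vcx vcv x y.
pose q := G x - G y; pose e := (3 * k)^-1 *: q.
have h1 := vcx x e; have h2 := vcv y (x - y + e); have h3 := vcx y (x - y).
have yx : y + (x - y) = x by rewrite addrC subrK.
move: h1 h2 h3; rewrite addrA !yx => h1 h2 h3.
have : inner q e <= 3 * k / 2 * (sqnorm e + sqnorm (x - y)).
  have := sqnormD_le (x - y) e; move: h1 h2 h3.
  rewrite !inner_lin; set a := inner (G x) e; set b := inner (G y) e.
  set u := sqnorm (x - y + e); set w := sqnorm e; set z := sqnorm (x - y).
  move=> h1 h2 h3 h4.
  have : k * u <= k * (2 * z + 2 * w) by rewrite ler_pM2l.
  by lra.
rewrite /e innerZr sqnormZ -/(sqnorm q) exprVn.
set z := sqnorm (x - y); set w := sqnorm q.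
have k3 : 0 < 3 * k by lra.
move=> h; have : (6 * k) * ((3 * k)^-1 * w) <=
   (6 * k) * (3 * k / 2 * (((3 * k) ^+ 2)^-1 * w + z)) by rewrite ler_pM2l //; lra.
have -> : (6 * k) * ((3 * k)^-1 * w) = 2 * w by field; rewrite gt_eqF.
have -> : (6 * k) * (3 * k / 2 * (((3 * k) ^+ 2)^-1 * w + z)) = w + 9 * k ^+ 2 * z.
  by field; rewrite gt_eqF.
by lra.
Qed.

(** A step of length [1 / k] along the slope must not leave the range of [v]. *)
Lemma field_bounded v G k M : 0 < k -> semiconvex_along v G k ->
  (forall x, `|v x| <= M) -> forall x, sqnorm (G x) <= 4 * k * M.
Proof.
move=> k0 vcx vM x; have := vcx x (k^-1 *: G x).
rewrite innerZr -/(sqnorm _) sqnormZ exprVn.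
have /ler_normlP[h1 _] := vM x; have /ler_normlP[_ h2] := vM (x + k^-1 *: G x).
set w := sqnorm _; move=> h3.
have : 2 * k * (k^-1 * w - k / 2 * ((k ^+ 2)^-1 * w)) <= 2 * k * (2 * M).
  by rewrite ler_pM2l; lra.
have -> : 2 * k * (k^-1 * w - k / 2 * ((k ^+ 2)^-1 * w)) = w.
  by field; rewrite gt_eqF.
by lra.
Qed.

(** Only the terms linear in [e] survive as [e] shrinks along [g - h]. *)
Lemma slope_unique (g h : 'rV[R]_d) (c r : R) : 0 < r ->
  (forall e, sqnorm e < r -> inner g e <= inner h e + c * sqnorm e) -> g = h.
Proof.
move=> r0 gh; apply/eqP; rewrite -subr_eq0 -sqnorm_eq0 -/(g - h).
set q := g - h; apply/eqP/le_anti; rewrite sqnorm_ge0 andbT leNgt.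
apply/negP => q0.
have c0 : 0 < (`|c| + 1)^-1 by rewrite invr_gt0 ltr_wpDl.
have [s /andP[s0 sc] sr] := exists_small_scale c0 (ltW q0) r0.
have := gh (s *: q); rewrite sqnormZ => /(_ sr); rewrite !innerZr => h1.
have : s * sqnorm q <= s * (`|c| * s * sqnorm q).
  have gE : inner g q = inner h q + sqnorm q.
    by rewrite /sqnorm /q !inner_lin; ring.
  apply: (@le_trans _ _ (c * (s ^+ 2 * sqnorm q))); first by move: h1; rewrite gE; lra.
  rewrite [leRHS](_ : _ = `|c| * (s ^+ 2 * sqnorm q)); last by ring.
  by apply: ler_wpM2r; [rewrite mulr_ge0 ?sqr_ge0 ?ltW|exact: ler_norm].
rewrite ler_pM2l // -[leLHS]mul1r ler_pM2r //.
suff cs1 : `|c| * s < 1 by rewrite lt_geF.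
have : (`|c| + 1) * s <= 1.
  by rewrite mulrC -ler_pdivlMr ?ltr_wpDl // div1r.
by rewrite mulrDl mul1r; lra.
Qed.

End SecondOrderBounds.

(** * From touching paraboloids to pointwise second-order bounds *)

Section Touching.
Context {R : realType} {d : nat}.
Implicit Types (v : 'rV[R]_d -> R) (G : 'rV[R]_d -> 'rV[R]_d) (e x y z g : 'rV[R]_d).

(** The viscosity form of [D^2 v <= N (Dv)] for paraboloids that touch [v] from
    below locally. *)
Definition touching_le v (N : 'rV[R]_d -> 'rV[R]_d -> R) :=
  forall x g (S : 'M[R]_d) r, 0 < r ->
    (forall e, sqnorm e < r ->
       v x + inner g e + inner (e *m S) e / 2 <= v (x + e)) ->
    forall e, inner (e *m S) e <= N g e.

Definition usc_quadratic (N : 'rV[R]_d -> 'rV[R]_d -> R) :=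
  forall p eps, 0 < eps -> exists2 r, 0 < r & forall q, sqnorm (q - p) < r ->
    forall e, N q e <= N p e + eps * sqnorm e.

Lemma slope_of_touching v G k x g (S : 'M[R]_d) (r : R) : 0 < r ->
  semiconcave_along v G k ->
  (forall e, sqnorm e < r ->
     v x + inner g e + inner (e *m S) e / 2 <= v (x + e)) ->
  g = G x.
Proof.
move=> r0 vcv touch; apply: (@slope_unique _ _ _ _ (k / 2 + mxsum S / 2) r r0).
by move=> e er; have := touch e er; have := vcv x e; have := quad_form_ge S e; lra.
Qed.

Lemma mulmx_rank1_scalar (a b : R) (l e : 'rV[R]_d) :
  e *m (a *: (l^T *m l) - b%:M) = (a * inner e l) *: l - b *: e.
Proof.
rewrite mulmxBr mul_mx_scalar -scalemxAr mulmxA.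
by rewrite [e *m l^T]mx11_scalar -/(inner e l) mul_scalar_mx scalerA.
Qed.

(** If the expansion of [v] at [y] failed at [y + e], then along the segment from
    [y] to [y + e] the function [v] would lie above a parabola that is too steep.
    Adding a small linear term, and a large concave term [- B P] in the directions
    orthogonal to [e], turns this parabola into a paraboloid which, up to a
    constant, touches [v] from below at an interior point of the tube of radius
    [|e|] around the segment. In the direction
    [e] its second derivative is too large for the touching property, since slopes
    vary continuously and [N] is upper semicontinuous. *)
Lemma hessian_le_of_touching v G k N : 0 < k -> continuous v ->
  semiconvex_along v G k -> semiconcave_along v G k ->
  usc_quadratic N -> touching_le v N -> hessian_le v G N.
Proof.
move=> k0 cv vcx vcv Nusc touch y eps eps0.
have [r0 r00 hr0] := Nusc (G y) eps eps0.
have k90 : 0 < 9 * k ^+ 2 by rewrite mulr_gt0 ?exprn_gt0.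
exists (r0 / (9 * k ^+ 2) / 2); first by rewrite !divr_gt0.
move=> e; rewrite ltr_pdivlMr // ltr_pdivlMr // => er.
rewrite leNgt; apply/negP => gap.
pose n := sqnorm e.
have n0 : 0 < n.
  rewrite sqnorm_gt0; apply/negP => /eqP e0; move: gap.
  rewrite e0 addr0 inner0r sqnorm0.
  have touch0 e' : sqnorm e' < 1 ->
      v y + inner (G y) e' + inner (e' *m (- k%:M)) e' / 2 <= v (y + e').
    move=> _; have := vcx y e'.
    by rewrite mulmxN innerNl inner_scalar_mx -/(sqnorm _); lra.
  by have := touch y (G y) _ 1 ltr01 touch0 0; rewrite mul0mx inner0l; lra.
pose ka := N (G y) e / 2 + eps * n.
pose beta := v (y + e) - v y - inner (G y) e - ka.
have beta0 : 0 < beta by rewrite /beta /ka /n; lra.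
pose mu := beta / 2.
have mu0 : 0 < mu by rewrite /mu; lra.
pose q := G (y + e) - G y.
pose c := sqnorm q / beta + 1.
have c0 : 0 < c by rewrite ltr_wpDl // divr_ge0 ?sqnorm_ge0 ?ltW.
have cq : c^-1 * sqnorm q <= beta.
  rewrite mulrC ler_pdivrMr // /c mulrDr mulrCA divff ?gt_eqF // !mulr1.
  by rewrite lerDl ltW.
(* [B] makes the minimised function [m] below nonnegative on the two ends and on
   the lateral side of the tube; on the segment [m] takes negative values. *)
pose B := k + (`|ka| + mu) / n + c.
have Bn : `|ka| + mu <= (B - k) * n.
  have -> : (B - k) * n = `|ka| + mu + c * n.
    by rewrite /B; field; rewrite gt_eqF.
  by rewrite lerDl mulr_ge0 ?ltW.
have Bc : k + c <= B.
  rewrite /B addrAC lerDl; apply: divr_ge0; last exact: ltW.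
  by apply: addr_ge0 => //; exact: ltW.
have B0 : 0 < B by lra.
pose t z := inner z e / n.
pose P z := sqnorm z - t z ^+ 2 * n.
have P0 z : 0 <= P z.
  have := sqnorm_ge0 (z - t z *: e).
  rewrite sqnormB innerZr sqnormZ -/n.
  have -> : inner z e = t z * n by rewrite /t divfK // gt_eqF.
  by rewrite /P; lra.
pose m z := v (y + z) - v y - inner (G y) z - t z ^+ 2 * ka - mu * t z + B * P z.
have ct : continuous t.
  by move=> z; apply: continuous_atM; [exact: inner_continuous|exact: continuous_at_cst].
have cP : continuous P.
  move=> z; apply: continuous_atB; first exact: sqnorm_continuous.
  by apply: continuous_atM; [apply: continuous_at_sqr; exact: ct|exact: continuous_at_cst].
have cm : continuous m.
  have cvy : continuous (fun z => v (y + z)).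
    move=> z; apply: (@continuous_comp _ _ _ (fun z => y + z) v); last exact: cv.
    exact: translate_continuous.
  move=> z; rewrite /m; apply: continuous_atD; last first.
    by apply: continuous_atM; [exact: continuous_at_cst|exact: cP].
  apply: continuous_atB; last by apply: continuous_atM; [exact: continuous_at_cst|exact: ct].
  apply: continuous_atB; last first.
    by apply: continuous_atM; [apply: continuous_at_sqr; exact: ct|exact: continuous_at_cst].
  apply: continuous_atB; last exact: inner_continuousr.
  by apply: continuous_atB; [exact: cvy|exact: continuous_at_cst].
(* The tube around the segment [y, y + e] on which the minimum is taken. *)
pose D := [set z | - t z <= 0] `&` [set z | t z <= 1] `&` [set z | P z <= n].
have D2n z : D z -> sqnorm z <= 2 * n.
  move=> [[/= h1 h2] h3].
  have : t z ^+ 2 <= 1 by rewrite expr_le1 //; lra.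
  by move: h3; rewrite /P => h3 h4; have : t z ^+ 2 * n <= 1 * n; [rewrite ler_pM2r|lra].
have cD : compact D.
  apply: (compact_sqnorm_le _ D2n).
  apply: closedI; last exact: closed_sublevel.
  apply: closedI; apply: closed_sublevel => //.
  by move=> z; apply: continuous_atN; exact: ct.
have D0 : D !=set0.
  by exists 0; rewrite /D /P /t /= inner0l sqnorm0 mul0r expr0n /=; do !split; lra.
have [z0 z0D z0min] := compact_EVT_min D0 cD (continuous_subspaceT cm).
rewrite inE in z0D.
have tseg s : t (s *: e) = s by rewrite /t innerZl mulfK // gt_eqF.
have Pseg s : P (s *: e) = 0 by rewrite /P tseg sqnormZ -/n subrr.
have mz0 : m z0 < 0.
  have a0 : 0 <= k / 2 * n + `|ka| + 1.
    by rewrite !addr_ge0 // mulr_ge0 ?ltW //; lra.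
  have [s /andP[s0 s1] sr] := exists_small_scale ltr01 (sqr_ge0 (k / 2 * n + `|ka| + 1))
                       (exprn_gt0 2 mu0).
  have sDD : s *: e \in D.
    by rewrite inE /D /= tseg Pseg; do !split; lra.
  apply: le_lt_trans (z0min _ sDD) _.
  have := vcv y (s *: e); rewrite /m tseg Pseg sqnormZ -/n innerZr.
  have : s * (k / 2 * n + `|ka| + 1) < mu.
    move: sr; rewrite -exprMn ltr_pXn2r // nnegrE ?(ltW mu0) //.
    by rewrite mulr_ge0 // ltW.
  set w := v (y + s *: e) => h1 h2.
  have : s * (s * (k / 2 * n + `|ka| + 1)) < s * mu by rewrite ltr_pM2l.
  have : - (s ^+ 2 * ka) <= s ^+ 2 * `|ka|.
    by rewrite -mulrN ler_wpM2l ?sqr_ge0 // -normrN ler_norm.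
  have : 0 <= s ^+ 2 by exact: sqr_ge0.
  by move: h2; rewrite !expr2; lra.
have sqka z : D z -> - `|ka| - mu <= - (t z ^+ 2 * ka) - mu * t z.
  move=> [[/= h1 h2] _].
  have tt : t z ^+ 2 <= 1 by rewrite expr_le1 //; lra.
  have : t z ^+ 2 * ka <= 1 * `|ka|.
    apply: (@le_trans _ _ (t z ^+ 2 * `|ka|)).
      by rewrite ler_wpM2l ?sqr_ge0 // ler_norm.
    by rewrite ler_wpM2r.
  have : mu * t z <= mu * 1 by rewrite ler_pM2l.
  by lra.
have [[/= t00 t01] Pn] := z0D.
have tpos : 0 < t z0.
  rewrite lt_neqAle; apply/andP; split; last by lra.
  apply/negP => /eqP t0; move: mz0; rewrite /m -t0 expr0n /=.
  have := vcx y z0; have : sqnorm z0 = P z0 by rewrite /P -t0 expr0n /= mul0r subr0.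
  move=> ->; have : (k / 2) * P z0 <= B * P z0 by rewrite ler_wpM2r //; lra.
  by lra.
have tlt1 : t z0 < 1.
  rewrite lt_neqAle t01 andbT; apply/negP => /eqP t1.
  pose z := z0 - e.
  have ze : inner z e = 0.
    have : inner z0 e = n by rewrite -[RHS]mul1r -t1 /t divfK // gt_eqF.
    by rewrite /z !inner_lin => ->; rewrite subrr.
  have z0E : z0 = z + e by rewrite /z subrK.
  have PzE : P z0 = sqnorm z.
    by rewrite /P t1 {1}z0E sqnormD ze -/n; ring.
  move: mz0; rewrite /m t1 PzE z0E addrCA addrA (addrC z y) -addrA (addrC z) addrA.
  have := vcx (y + e) z; rewrite innerDr.
  have : 2 * inner (- q) z <= c^-1 * sqnorm (- q) + c * sqnorm z.
    by have := @inner_young _ _ c^-1 (- q) z; rewrite invr_gt0 invrK; apply.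
  rewrite sqnormN /q !inner_lin -/q expr1n.
  have := sqnorm_ge0 z; set w := sqnorm z => w0.
  have : (k + c) * w <= B * w by rewrite ler_wpM2r.
  set gg := inner (G y) z; set hh := inner (G (y + e)) z.
  have : beta = v (y + e) - v y - inner (G y) e - ka by [].
  have : mu = beta / 2 by [].
  have : 0 <= c * w by rewrite mulr_ge0 // ltW.
  have : 0 <= k * w by rewrite mulr_ge0 // ltW.
  set v1 := v (_ + _); set v2 := v (_ + _).
  by lra.
have Pltn : P z0 < n.
  rewrite lt_neqAle Pn andbT; apply/negP => /eqP PE.
  have := D2n _ z0D; have := sqka _ z0D; have := vcx y z0; move: mz0.
  rewrite /m PE => h1 h2 h3 h4.
  have : k * sqnorm z0 <= k * (2 * n) by rewrite ler_pM2l.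
  by lra.
have [r r_gt0 rD] : exists2 s, 0 < s & forall e', sqnorm e' < s -> D (z0 + e').
  apply/(nbhs_sqnormP z0 D).
  apply: filterI; [apply: filterI|].
  - have : \forall z \near z0, 0 < t z by exact: near_gt_of_continuous tpos.
    by apply: filterS => z /=; lra.
  - have : \forall z \near z0, t z < 1 by exact: near_lt_of_continuous tlt1.
    by apply: filterS => z /=; lra.
  - have : \forall z \near z0, P z < n by exact: near_lt_of_continuous Pltn.
    by apply: filterS => z /=; lra.
pose l := n^-1 *: e.
have tE z : t z = inner z l by rewrite /t /l innerZr mulrC.
clearbody l.
pose g := G y + (2 * t z0 * ka + mu + 2 * B * t z0 * n) *: l - (2 * B) *: z0.
pose S : 'M[R]_d := (2 * ka + 2 * B * n) *: (l^T *m l) - (2 * B)%:M.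
have Stouch e' : sqnorm e' < r ->
    v (y + z0) + inner g e' + inner (e' *m S) e' / 2 <= v (y + z0 + e').
  move=> /rD De'; have := z0min _ (mem_set De').
  rewrite /m /P !tE !inner_lin sqnormD (addrA y).
  rewrite /g /S mulmx_rank1_scalar !inner_lin !tE (innerC l e') -/(sqnorm e').
  set v1 := v (_ + _); set v2 := v (_ + _).
  by rewrite !expr2; lra.
have gE : g = G (y + z0) by exact: slope_of_touching Stouch.
have := touch _ _ _ _ r_gt0 Stouch e.
rewrite /S mulmx_rank1_scalar !inner_lin -!tE (innerC l) -tE.
have te : t e = 1 by rewrite /t -/(sqnorm e) -/n divff // gt_eqF.
rewrite te -/(sqnorm e) -/n.
have gr0 : sqnorm (g - G y) < r0.
  rewrite gE; apply: le_lt_trans (field_lipschitz k0 vcx vcv _ _) _.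
  rewrite addrAC subrr add0r.
  have : 9 * k ^+ 2 * sqnorm z0 <= 9 * k ^+ 2 * (2 * n).
    by rewrite ler_pM2l //; exact: D2n.
  by rewrite /n; lra.
have := hr0 g gr0 e; rewrite -/n /ka.
have : 0 < eps * n by rewrite mulr_gt0.
by lra.
Qed.

End Touching.

(** * Uniformly convex Hamiltonians and the inverse Hessian form *)

Section ConvexData.
Context {R : realType} {d : nat}.
Implicit Types (e p q x y : 'rV[R]_d) (B : 'M[R]_d).

(** What is needed of a uniformly convex Hamiltonian of class C^2: [DH] is its
    gradient and [A] its Hessian. The reflected Hamiltonian [H (- p)] satisfies
    the same properties, which is what reduces the equation [u_t = - H (Du)] to
    [u_t = H (Du)]. *)
Record convex_data (H : 'rV[R]_d -> R) (DH : 'rV[R]_d -> 'rV[R]_d)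
    (A : 'rV[R]_d -> 'M[R]_d) (th Th : R) : Prop := ConvexData {
  cd_lower_gt0 : 0 < th;
  cd_upper_gt0 : 0 < Th;
  cd_sym : forall p, (A p)^T = A p;
  cd_elliptic : forall p e, th * sqnorm e <= inner (e *m A p) e;
  cd_continuous : forall p eps, 0 < eps -> exists2 r, 0 < r &
    forall q, sqnorm (q - p) < r ->
      forall e, sqnorm (e *m (A q - A p)) <= eps * sqnorm e;
  cd_convex : semiconvex_along H DH (- th);
  cd_upper : semiconcave_along H DH Th;
  cd_taylor1 : forall p eps, 0 < eps -> exists2 r, 0 < r &
    forall q, sqnorm q < r ->
      sqnorm (DH (p + q) - DH p - q *m A p) <= eps * sqnorm q;
  cd_taylor2 : forall p eps, 0 < eps -> exists2 r, 0 < r &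
    forall q, sqnorm q < r ->
      H (p + q) <= H p + inner (DH p) q + inner (q *m A p) q / 2 + eps * sqnorm q
}.

(** Since [F = sqrt (D^2 H)], the inequality [F S F <= K I] is the same as
    [S <= K (D^2 H)^-1], which involves no square root. *)
Definition inv_form (A : 'rV[R]_d -> 'M[R]_d) p e := inner (e *m invmx (A p)) e.

Lemma elliptic_unitmx B (th : R) : 0 < th ->
  (forall e, th * sqnorm e <= inner (e *m B) e) -> B \in unitmx.
Proof.
move=> th0 Bth; rewrite -row_free_unit -kermx_eq0; apply/eqP/row_matrixP => i.
rewrite row0; apply/eqP; rewrite -sqnorm_eq0; apply/eqP/le_anti.
rewrite sqnorm_ge0 andbT -(ler_pM2l th0) mulr0.
apply: le_trans (Bth _) _.
by rewrite -row_mul mulmx_ker row0 inner0l.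
Qed.

Lemma trmx_invmx B : B^T = B -> (invmx B)^T = invmx B.
Proof. by move=> Bs; rewrite trmx_inv Bs. Qed.

(** Integrated form of [(M^-1)' = - A] over a time [t], for [B = A^-1]: with
    [K' = K / (1 - K t)] the right side minus the left side is the completed square
    [K K' t] times the form [B] at [x - K^-1 y]. *)
Lemma riccati_le B (K t : R) x y : B^T = B -> (forall e, 0 <= inner (e *m B) e) ->
  0 < K -> 0 <= t -> 0 < 1 - K * t ->
  K * inner (x *m B) x - t * inner (y *m B) y
    <= K / (1 - K * t) * inner ((x - t *: y) *m B) (x - t *: y).
Proof.
move=> Bs B0 K0 t0 Kt; set K' := K / _.
have yx : inner (y *m B) x = inner (x *m B) y by rewrite inner_mulmx Bs innerC.
have K'0 : 0 < K' by rewrite divr_gt0.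
have : 0 <= K * K' * t * inner ((x - K^-1 *: y) *m B) (x - K^-1 *: y).
  by do 2 apply: mulr_ge0 => //; apply: mulr_ge0; exact: ltW.
rewrite !mulmxBl -!scalemxAl !inner_lin yx.
set a := inner (x *m B) x; set b := inner (x *m B) y; set c := inner (y *m B) y.
have -> : K = K' / (1 + K' * t).
  have h : 1 + K' * t != 0 by rewrite gt_eqF // ltr_wpDr // mulr_ge0 // ltW.
  apply/eqP; rewrite eq_sym -(inj_eq (mulIf h)) divfK //; apply/eqP.
  by rewrite /K'; field; rewrite gt_eqF.
have h : 0 < 1 + K' * t by rewrite ltr_wpDr // mulr_ge0 // ltW.
move=> h1; rewrite -subr_ge0; apply: (le_trans h1).
rewrite le_eqVlt; apply/orP; left; apply/eqP.
by field; rewrite !gt_eqF.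
Qed.

Section InverseForm.
Variables (H : 'rV[R]_d -> R) (DH : 'rV[R]_d -> 'rV[R]_d).
Variables (A : 'rV[R]_d -> 'M[R]_d) (th Th : R).
Hypothesis HA : convex_data H DH A th Th.

Let th0 : 0 < th. Proof. exact: (cd_lower_gt0 HA). Qed.

Lemma cd_unitmx p : A p \in unitmx.
Proof. exact: elliptic_unitmx th0 (cd_elliptic HA p). Qed.

Lemma inv_form_mulmx p e : inv_form A p (e *m A p) = inner (e *m A p) e.
Proof. by rewrite /inv_form mulmxK ?cd_unitmx // innerC. Qed.

Lemma sqnorm_mul_invmx p e :
  th * sqnorm (e *m invmx (A p)) <= inv_form A p e.
Proof.
apply: le_trans (cd_elliptic HA p _) _.
by rewrite mulmxKV ?cd_unitmx // innerC.
Qed.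

Lemma inv_form_ge0 p e : 0 <= inv_form A p e.
Proof.
apply: le_trans (sqnorm_mul_invmx p e).
by rewrite mulr_ge0 ?sqnorm_ge0 // ltW.
Qed.

Lemma inv_form_le p e : inv_form A p e <= th^-1 * sqnorm e.
Proof.
have := inner_young (e *m invmx (A p)) e th0; rewrite -/(inv_form A p e).
by have := sqnorm_mul_invmx p e; lra.
Qed.

(** Resolvent identity: the two inverse forms differ by the pairing of
    [e A(q)^-1 (A(q) - A(p))] with [e A(p)^-1]. *)
Lemma inv_form_usc (K : R) : 0 < K -> usc_quadratic (fun p e => K * inv_form A p e).
Proof.
move=> K0 p eps eps0.
pose c := eps / K.
have c0 : 0 < c by rewrite divr_gt0.
have [r r0 hr] := cd_continuous HA p (mulr_gt0 (exprn_gt0 2 c0) (exprn_gt0 4 th0)).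
exists r => // q qr e.
have Kc : K * c = eps by rewrite /c mulrCA divff ?mulr1 // gt_eqF.
rewrite -Kc -mulrA -mulrDr ler_pM2l //.
pose fp := e *m invmx (A p); pose fq := e *m invmx (A q).
have fpA : fp *m A p = e by rewrite mulmxKV ?cd_unitmx.
have fqA : fq *m A q = e by rewrite mulmxKV ?cd_unitmx.
have diffE : inv_form A q e - inv_form A p e = - inner (fq *m (A q - A p)) fp.
  rewrite mulmxBr fqA innerDl innerNl opprD opprK (innerC e).
  rewrite (inner_mulmx fq) (cd_sym HA) fpA.
  by rewrite /inv_form -/fp -/fq addrC.
have f_le p' : sqnorm (e *m invmx (A p')) <= (th ^+ 2)^-1 * sqnorm e.
  have := sqnorm_mul_invmx p' e; have := inv_form_le p' e.
  set a := sqnorm _; set b := inv_form _ _ _ => h1 h2.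
  rewrite -(ler_pM2l th0) (le_trans h2) // (le_trans h1) //.
  suff -> : th * ((th ^+ 2)^-1 * sqnorm e) = th^-1 * sqnorm e by [].
  by field; rewrite gt_eqF.
have := hr q qr fq.
have := @inner_young _ _ (c * th ^+ 2)^-1 (- (fq *m (A q - A p))) fp.
rewrite invr_gt0 invrK mulr_gt0 ?exprn_gt0 // => /(_ isT).
rewrite innerNl sqnormN -diffE.
have := f_le p; have := f_le q; rewrite -/fp -/fq.
set a := sqnorm fp; set b := sqnorm fq; set z := sqnorm (_ *m _).
set n := sqnorm e => hb ha h3 h4.
have c2 : 0 < c * th ^+ 2 by rewrite mulr_gt0 // exprn_gt0.
have ca : c * th ^+ 2 * a <= c * n.
  have : c * th ^+ 2 * a <= c * th ^+ 2 * ((th ^+ 2)^-1 * n) by rewrite ler_pM2l.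
  suff -> : c * th ^+ 2 * ((th ^+ 2)^-1 * n) = c * n by [].
  by field; rewrite gt_eqF.
have cz : (c * th ^+ 2)^-1 * z <= c * n.
  apply: (@le_trans _ _ ((c * th ^+ 2)^-1 * (c ^+ 2 * th ^+ 4 * ((th ^+ 2)^-1 * n)))).
    rewrite ler_pM2l ?invr_gt0 // (le_trans h4) // ler_pM2l //.
    by rewrite mulr_gt0 // exprn_gt0.
  suff -> : (c * th ^+ 2)^-1 * (c ^+ 2 * th ^+ 4 * ((th ^+ 2)^-1 * n)) = c * n by [].
  by field; rewrite !gt_eqF.
by lra.
Qed.

Lemma DH_lipschitz p q : sqnorm (DH p - DH q) <= 9 * Th ^+ 2 * sqnorm (p - q).
Proof.
apply: (field_lipschitz (cd_upper_gt0 HA)) (cd_upper HA) _ _.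
move=> x e; apply: le_trans (cd_convex HA x e); rewrite lerD2l.
have : 0 <= Th * sqnorm e by rewrite mulr_ge0 ?sqnorm_ge0 // ltW // (cd_upper_gt0 HA).
have : 0 <= th * sqnorm e by rewrite mulr_ge0 ?sqnorm_ge0 // ltW.
lra.
Qed.

Lemma convex_data_opp :
  convex_data (fun p => H (- p)) (fun p => - DH (- p)) (fun p => A (- p)) th Th.
Proof.
have := HA; case=> ? ? sy el co cx up t1 t2; split=> //.
- move=> p eps /(co (- p))[r r0 hr]; exists r => // q qp e.
  by apply: hr; rewrite -opprD sqnormN.
- by move=> y e; have := cx (- y) (- e); rewrite !innerNr -!innerNl sqnormN -opprD.
- by move=> y e; have := up (- y) (- e); rewrite !innerNr -!innerNl sqnormN -opprD.
- move=> p eps /(t1 (- p))[r r0 hr]; exists r => // q qr.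
  have := hr (- q); rewrite sqnormN mulNmx opprK => /(_ qr) h.
  by rewrite -[leLHS]sqnormN !opprD !opprK.
- move=> p eps /(t2 (- p))[r r0 hr]; exists r => // q qr.
  have := hr (- q); rewrite sqnormN mulNmx !innerNr !innerNl opprK => /(_ qr).
  by rewrite -opprD.
Qed.

End InverseForm.
End ConvexData.

(** * Comparison of a viscosity subsolution with a classical solution *)

Section Comparison.
Context {R : realType} {d : nat}.
Implicit Types (u w : 'rV[R]_d * R -> R) (Ham : 'rV[R]_d -> R) (z : 'rV[R]_d * R).

(** Viscosity subsolutions tested with paraboloids only. This is enough to
    compare with functions that have a first-order expansion with quadratic
    remainder at every point. *)
Definition paraboloid_subsolution Ham u :=
  forall z, open_half_space z -> forall (p : 'rV[R]_d) (b L : R),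
    (\forall z' \near z, u z' <= u z + inner p (z'.1 - z.1) + b * (z'.2 - z.2)
        + L * (sqnorm (z'.1 - z.1) + (z'.2 - z.2) ^+ 2)) ->
    b <= Ham p.

Definition locally_usc Ham := forall B eta : R, 0 < eta ->
  exists2 rho, 0 < rho & forall p q, sqnorm p <= B -> sqnorm q <= rho ->
    Ham (p + q) <= Ham p + eta.

Definition slab (s h : R) : set ('rV[R]_d * R) := [set z | s <= z.2 <= s + h].

(** The remainder estimate also holds for [z'] before [z], so that an interior
    point of a time slab can be compared with all its neighbours. *)
Definition classical_solution_on Ham w (S : set ('rV[R]_d * R)) :=
  exists B L : R, [/\ 0 <= L & forall z, S z -> exists2 p, sqnorm p <= B &
    forall z', S z' -> `|w z' - w z - inner p (z'.1 - z.1) - Ham p * (z'.2 - z.2)|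
      <= L * (sqnorm (z'.1 - z.1) + (z'.2 - z.2) ^+ 2)].

Lemma classical_solution_continuous Ham w S :
  classical_solution_on Ham w S -> {within S, continuous w}.
Proof.
move=> [B [L [L0 sol]]]; apply/subspace_continuousP => z Sz.
have [p _ hp] := sol z Sz.
pose E z' := `|inner p (z'.1 - z.1) + Ham p * (z'.2 - z.2)|
   + L * (sqnorm (z'.1 - z.1) + (z'.2 - z.2) ^+ 2).
have c1 : continuous (fun z' : 'rV[R]_d * R => z'.1 - z.1).
  by move=> z'; apply: cvgB; [exact: cvg_fst|exact: cvg_cst].
have c2 : continuous (fun z' : 'rV[R]_d * R => z'.2 - z.2).
  by move=> z'; apply: continuous_atB; [exact: cvg_snd|exact: continuous_at_cst].
have cE : continuous E.
  move=> z'; apply: continuous_atD; last first.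
    apply: continuous_atM; first exact: continuous_at_cst.
    apply: continuous_atD; last by apply: continuous_at_sqr; exact: c2.
    apply: (@continuous_comp _ _ _ (fun z' => z'.1 - z.1) sqnorm); first exact: c1.
    exact: sqnorm_continuous.
  apply: (@continuous_comp _ _ _ (fun z' => _ + _) (fun r : R => `|r|)).
    apply: continuous_atD; last by apply: continuous_atM; [exact: continuous_at_cst|exact: c2].
    apply: (@continuous_comp _ _ _ (fun z' => z'.1 - z.1) (inner p)); first exact: c1.
    exact: inner_continuousr.
  exact: norm_continuous.
have E0 : E z = 0.
  by rewrite /E !subrr inner0r sqnorm0 mulr0 addr0 normr0 expr0n /= !add0r mulr0.
apply/cvgrPdist_lt => eps eps0.
have : \forall z' \near z, E z' < eps by apply: near_lt_of_continuous; rewrite ?E0.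
apply: filterS => z' Ez' Sz'; apply: le_lt_trans Ez'.
rewrite distrC /E; have := hp z' Sz'.
set a := inner _ _; set b := Ham p * _; set c := L * _ => h.
have -> : w z' - w z = (w z' - w z - a - b) + (a + b) by ring.
by rewrite addrC; apply: le_trans (ler_normD _ _) _; rewrite lerD.
Qed.

Definition pos_part (r : R) : R := Num.max r 0.

Lemma sqr_pos_part_le (r r' : R) :
  pos_part r' ^+ 2 <= pos_part r ^+ 2 + 2 * pos_part r * (r' - r) + (r' - r) ^+ 2.
Proof.
have h : 0 <= r' ^+ 2 by exact: sqr_ge0.
have k : 0 <= (r' - r) ^+ 2 by exact: sqr_ge0.
rewrite /pos_part; have [r'0|r'0] := leP r' 0; have [r0|r0] := leP r 0; try lra.
have : 0 <= r' * - r by apply: mulr_ge0; lra.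
by have : 0 <= r ^+ 2 by [exact: sqr_ge0]; lra.
Qed.

Lemma pos_part_continuous : continuous pos_part.
Proof.
by move=> r; apply: (@continuous_max R R id (fun=> 0)); [exact: cvg_id|exact: cvg_cst].
Qed.

(** Since [w] is differentiable, it can enter the test function itself: the
    difference [u - w] is maximised after subtracting [de * |x|^2] for compactness,
    [eta * (t - s)] for strictness, and a multiple of the square of
    [(t - s - h / 2)_+] which keeps the maximum away from the final time. At the
    maximum [w] plus the penalties is bounded above by a paraboloid, which is an
    admissible test function. *)
Lemma comparison Ham u w (s h M : R) : 0 <= s -> 0 < h ->
  locally_usc Ham -> paraboloid_subsolution Ham u ->
  {within closed_half_space, continuous u} ->
  classical_solution_on Ham w (slab s h) ->
  (forall z, slab s h z -> u z - w z <= M) ->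
  (forall x, u (x, s) <= w (x, s)) ->
  forall x t, s <= t <= s + h / 2 -> u (x, t) <= w (x, t).
Proof.
move=> s0 h0 Husc usub uc wsol uwM uws x1 t1 t1I.
have wc := classical_solution_continuous wsol.
rewrite leNgt; apply/negP => gap.
pose M1 := `|M| + 1.
have M10 : 0 < M1 by rewrite ltr_wpDl.
have uwM1 z : slab s h z -> u z - w z <= M1.
  by move=> /uwM; rewrite /M1; have := ler_norm M; lra.
pose m := u (x1, t1) - w (x1, t1).
have m0 : 0 < m by rewrite subr_gt0.
pose eta := m / (2 * h).
have eta0 : 0 < eta by rewrite divr_gt0 // mulr_gt0.
have etah : eta * h = m / 2 by rewrite /eta; field; rewrite gt_eqF.
pose ka := 4 * M1 / h ^+ 2.
have ka0 : 0 < ka by rewrite divr_gt0 ?exprn_gt0 // mulr_gt0.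
have kah : ka * (h / 2) ^+ 2 = M1 by rewrite /ka; field; rewrite gt_eqF.
have [B [L [L0 sol]]] := wsol.
have [rho rho0 hrho] := Husc B (eta / 2) (divr_gt0 eta0 (ltr0Sn _ 1)).
(* The penalty must stay below half the gap at [x1], and its gradient at the
   maximum, whose square is at most [4 de M1], below the modulus [rho] of [Ham]. *)
pose de := Num.min (rho / (4 * M1)) (m / (4 * (sqnorm x1 + 1))).
have x10 : 0 < sqnorm x1 + 1 by rewrite ltr_wpDl ?sqnorm_ge0.
have de0 : 0 < de by rewrite lt_min !divr_gt0 // mulr_gt0.
have deM : 4 * (de * M1) <= rho.
  have : de <= rho / (4 * M1) by rewrite ge_min lexx.
  by rewrite ler_pdivlMr ?mulr_gt0 //; lra.
have dex : de * sqnorm x1 < m / 2.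
  have : de <= m / (4 * (sqnorm x1 + 1)) by rewrite ge_min lexx orbT.
  by rewrite ler_pdivlMr ?mulr_gt0 //; lra.
pose r z := z.2 - (s + h / 2) : R.
pose Psi z := u z - w z - de * sqnorm z.1 - eta * (z.2 - s) - ka * pos_part (r z) ^+ 2.
pose D := [set x : 'rV[R]_d | sqnorm x <= M1 / de] `*` `[s, s + h]%classic.
have DS : D `<=` slab s h by move=> z [_]; rewrite /= in_itv.
have cD : compact D.
  apply: compact_setX; last exact: segment_compact.
  apply: (@compact_sqnorm_le _ _ _ (M1 / de)) => //.
  by apply: closed_sublevel; exact: sqnorm_continuous.
have Psi1 : 0 < Psi (x1, t1).
  rewrite /Psi /= -/m /r /= /pos_part max_r ?expr0n /= ?mulr0 ?subr0; last by lra.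
  have : eta * (t1 - s) <= eta * (h / 2) by rewrite ler_pM2l //; lra.
  by lra.
have PsiD z : slab s h z -> 0 < Psi z ->
    [/\ de * sqnorm z.1 < M1, s < z.2 & z.2 < s + h].
  move=> Sz Pz; have /andP[z1 z2] := Sz.
  have q0 : 0 <= ka * pos_part (r z) ^+ 2 by rewrite mulr_ge0 ?sqr_ge0 // ltW.
  have e0 : 0 <= eta * (z.2 - s) by rewrite mulr_ge0 ?subr_ge0 // ltW.
  have d0 : 0 <= de * sqnorm z.1 by rewrite mulr_ge0 ?sqnorm_ge0 // ltW.
  have uwz := uwM1 z Sz.
  move: Pz; rewrite /Psi => Pz; split; first by lra.
  - rewrite lt_neqAle z1 andbT; apply/negP => /eqP zs.
    by have := uws z.1; rewrite {1 2}zs -surjective_pairing; lra.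
  - rewrite lt_neqAle z2 andbT; apply/negP => /eqP zs.
    have rz : r z = h / 2 by rewrite /r zs; field.
    have ppE : pos_part (r z) = h / 2 by rewrite rz /pos_part max_l //; lra.
    by move: Pz; rewrite ppE kah; lra.
have S1 : slab s h (x1, t1) by rewrite /slab /=; lra.
have D1 : D (x1, t1).
  split=> /=; last by rewrite in_itv.
  have [] := PsiD _ S1 Psi1 => /ltW /=.
  by rewrite mulrC -ler_pdivlMr.
have cPsi : {within D, continuous Psi}.
  have c1 : continuous (fun z : 'rV[R]_d * R => z.1) by move=> z; exact: cvg_fst.
  have c2 : continuous (fun z : 'rV[R]_d * R => z.2) by move=> z; exact: cvg_snd.
  have cpen : {within D, continuous (fun z => de * sqnorm z.1 + eta * (z.2 - s)
      + ka * pos_part (r z) ^+ 2)}.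
    apply: continuous_subspaceT => z; apply: continuous_atD.
      apply: continuous_atD.
        apply: continuous_atM; first exact: continuous_at_cst.
        apply: (@continuous_comp _ _ _ fst sqnorm); [exact: c1|exact: sqnorm_continuous].
      by apply: continuous_atM; [exact: continuous_at_cst|apply: continuous_atB; [exact: c2|exact: continuous_at_cst]].
    apply: continuous_atM; first exact: continuous_at_cst.
    apply: continuous_at_sqr; apply: (@continuous_comp _ _ _ r pos_part).
      by apply: continuous_atB; [exact: c2|exact: continuous_at_cst].
    exact: pos_part_continuous.
  have cu : {within D, continuous u}.
    apply: continuous_subspaceW uc => z [_] /=; rewrite in_itv /= => /andP[z1 _].
    exact: le_trans s0 z1.
  have cw : {within D, continuous w} by exact: continuous_subspaceW DS wc.
  have -> : Psi = (fun z => u z - w z - (de * sqnorm z.1 + eta * (z.2 - s)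
      + ka * pos_part (r z) ^+ 2)) by apply/funext => z; rewrite /Psi; ring.
  by move=> z; apply: continuous_atB; [apply: continuous_atB; [exact: cu|exact: cw]|exact: cpen].
have [z0 z0D z0max] := compact_EVT_max (ex_intro _ _ D1) cD cPsi.
rewrite inE in z0D.
have Psi0 : 0 < Psi z0.
  by apply: lt_le_trans Psi1 _; apply: z0max; rewrite inE.
have S0 := DS _ z0D.
have [z0x z0s z0h] := PsiD _ S0 Psi0.
have [p pB hp] := sol z0 S0.
pose q := (2 * de) *: z0.1.
pose b := Ham p + eta + 2 * ka * pos_part (r z0).
have z0pos : open_half_space z0 by rewrite /open_half_space /=; lra.
have : b <= Ham (p + q).
  apply: (usub z0 z0pos (p + q) b (L + de + ka)).
  have n1 : \forall z \near z0, s < z.2 by apply: near_gt_of_continuous z0s; exact: cvg_snd.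
  have n2 : \forall z \near z0, z.2 < s + h by apply: near_lt_of_continuous z0h; exact: cvg_snd.
  have n3 : \forall z \near z0, de * sqnorm z.1 < M1.
    have c3 : continuous_at z0 (fun z => de * sqnorm z.1).
      apply: continuous_atM; first exact: continuous_at_cst.
      apply: (@continuous_comp _ _ _ fst sqnorm); first exact: cvg_fst.
      exact: sqnorm_continuous.
    exact: (near_lt_of_continuous c3 z0x).
  near=> z.
  have z1 : s < z.2 by near: z.
  have z2 : z.2 < s + h by near: z.
  have z3 : de * sqnorm z.1 < M1 by near: z.
  have Sz : slab s h z by rewrite /slab /=; lra.
  have Dz : z \in D.
    rewrite inE; split=> /=; last by rewrite in_itv.
    by move: z3 => /ltW; rewrite mulrC -ler_pdivlMr.
  have := z0max z Dz; rewrite /Psi.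
  have /ler_normlP[_] := hp z Sz.
  have := sqr_pos_part_le (r z0) (r z).
  have -> : r z - r z0 = z.2 - z0.2 by rewrite /r; ring.
  have zE : z.1 = z0.1 + (z.1 - z0.1) by rewrite addrC subrK.
  have -> : sqnorm z.1 = sqnorm z0.1 + 2 * inner z0.1 (z.1 - z0.1)
       + sqnorm (z.1 - z0.1) by rewrite {1}zE sqnormD.
  rewrite /b /q innerDl innerZl.
  set xx := sqnorm (z.1 - z0.1); set i1 := inner p _; set i2 := inner z0.1 _.
  set tt := z.2 - z0.2; set pp := pos_part (r z0); set pp' := pos_part (r z).
  have -> : z.2 - s = (z0.2 - s) + tt by rewrite /tt; ring.
  have xx0 : 0 <= xx by exact: sqnorm_ge0.
  have tt0 : 0 <= tt ^+ 2 by exact: sqr_ge0.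
  move=> h1 h2 h3.
  have : ka * pp' ^+ 2 <= ka * (pp ^+ 2 + 2 * pp * tt + tt ^+ 2) by rewrite ler_pM2l.
  have : 0 <= de * tt ^+ 2 by rewrite mulr_ge0 // ltW.
  have : 0 <= ka * xx by rewrite mulr_ge0 // ltW.
  by lra.
have qrho : sqnorm q <= rho.
  rewrite /q sqnormZ; apply: le_trans deM.
  have : de * (de * sqnorm z0.1) <= de * M1 by rewrite ler_pM2l // ltW.
  by lra.
have := hrho p q pB qrho.
have : 0 <= 2 * ka * pos_part (r z0).
  by apply: mulr_ge0; [rewrite mulr_ge0 // ltW|rewrite /pos_part le_max lexx orbT].
by rewrite /b; lra.
Unshelve. all: end_near. Qed.

End Comparison.

(** * The classical solution built from characteristics *)

Section Characteristics.
Context {R : realType} {d : nat}.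
Implicit Types (e p q x y : 'rV[R]_d).

Lemma sqnorm_lipschitz_continuous (L : R) (f : 'rV[R]_d -> 'rV[R]_d) :
  (forall x y, sqnorm (f x - f y) <= L * sqnorm (x - y)) -> continuous f.
Proof.
move=> fL x A /nbhs_sqnormP[r r0 hA]; apply/nbhs_sqnormP.
have L0 : 0 < `|L| + 1 by rewrite ltr_wpDl.
exists (r / (`|L| + 1)); first by rewrite divr_gt0.
move=> e; rewrite ltr_pdivlMr // => er; rewrite /preimage /=.
have -> : f (x + e) = f x + (f (x + e) - f x) by rewrite [RHS]addrC subrK.
apply: hA; apply: le_lt_trans (fL _ _) _; rewrite addrAC subrr add0r.
apply: le_lt_trans er; rewrite mulrC; apply: ler_wpM2l; first exact: sqnorm_ge0.
by have := ler_norm L; lra.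
Qed.

(** A contraction of the Euclidean norm has a fixed point: a minimiser of the
    displacement cannot have a nonzero displacement. *)
Lemma contraction_fixpoint (Cg Lg t : R) (g : 'rV[R]_d -> 'rV[R]_d) x :
  (forall y, sqnorm (g y) <= Cg) ->
  (forall y y', sqnorm (g y - g y') <= Lg * sqnorm (y - y')) ->
  t ^+ 2 * Lg < 1 ->
  exists y, y = x + t *: g y.
Proof.
move=> gC gL tL.
pose psi y := y - (x + t *: g y).
have psic : continuous psi.
  apply: (@sqnorm_lipschitz_continuous (2 + 2 * (t ^+ 2 * Lg))) => y y'.
  have -> : psi y - psi y' = (y - y') + t *: (g y' - g y).
    rewrite /psi scalerBr; apply/rowP => i; rewrite !mxE; ring.
  apply: le_trans (sqnormD_le _ _) _; rewrite sqnormZ.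
  have := gL y' y; rewrite -(sqnormN (y' - y)) opprB => h.
  have : t ^+ 2 * sqnorm (g y' - g y) <= t ^+ 2 * (Lg * sqnorm (y - y')).
    by rewrite ler_wpM2l ?sqr_ge0.
  by lra.
pose rho := 2 * sqnorm x + 8 * (t ^+ 2 * Cg).
have psix : sqnorm (psi x) <= t ^+ 2 * Cg.
  rewrite /psi opprD addrA subrr add0r sqnormN sqnormZ.
  by rewrite ler_wpM2l ?sqr_ge0.
pose K := [set y : 'rV[R]_d | sqnorm y <= rho].
have cK : compact K.
  by apply: (@compact_sqnorm_le _ _ K rho) => //; apply: closed_sublevel; exact: sqnorm_continuous.
have psixK y : sqnorm (psi y) <= sqnorm (psi x) -> K y.
  move=> yx; rewrite /K /=.
  have -> : y = (psi y + t *: g y) + x.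
    by rewrite /psi; apply/rowP => i; rewrite !mxE; ring.
  have h1 := sqnormD_le (psi y + t *: g y) x.
  have h2 := sqnormD_le (psi y) (t *: g y); rewrite sqnormZ in h2.
  have : t ^+ 2 * sqnorm (g y) <= t ^+ 2 * Cg by rewrite ler_wpM2l ?sqr_ge0.
  by rewrite /rho; lra.
have K0 : K !=set0 by exists x; exact: psixK.
have cpsi : {within K, continuous (fun y => sqnorm (psi y))}.
  apply: continuous_subspaceT => y.
  by apply: (@continuous_comp _ _ _ psi sqnorm); [exact: psic|exact: sqnorm_continuous].
have [y0 _ y0min] := compact_EVT_min K0 cK cpsi.
exists y0; apply/eqP; rewrite -subr_eq0 -sqnorm_eq0 -/(psi y0).
have [//|n0] := eqVneq (sqnorm (psi y0)) 0.
pose y1 := y0 - psi y0.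
have y1E : y1 = x + t *: g y0 by rewrite /y1 /psi opprB addrCA subrr addr0.
have psi1 : sqnorm (psi y1) < sqnorm (psi y0).
  rewrite {1}/psi {1}y1E opprD addrACA subrr add0r -scalerBr sqnormZ.
  apply: le_lt_trans (_ : t ^+ 2 * (Lg * sqnorm (psi y0)) < _).
    rewrite ler_wpM2l ?sqr_ge0 //; apply: le_trans (gL _ _) _.
    by rewrite /y1 opprB addrCA subrr addr0.
  rewrite mulrA -[ltRHS]mul1r ltr_pM2r //.
  by rewrite lt_neqAle eq_sym n0 sqnorm_ge0.
have : sqnorm (psi y0) <= sqnorm (psi y1).
  apply: (y0min _); rewrite inE; apply: (psixK _); apply: le_trans (ltW psi1) _.
  by apply: (y0min _); rewrite inE; exact: psixK.
by rewrite leNgt psi1.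
Qed.

Variables (H : 'rV[R]_d -> R) (DH : 'rV[R]_d -> 'rV[R]_d).
Variables (A : 'rV[R]_d -> 'M[R]_d) (th Th : R).
Hypothesis HA : convex_data H DH A th Th.
Variables (v : 'rV[R]_d -> R) (G : 'rV[R]_d -> 'rV[R]_d) (k M : R).
Hypotheses (k0 : 0 < k) (vM : forall x, `|v x| <= M).
Hypotheses (vcx : semiconvex_along v G k) (vcv : semiconcave_along v G k).

Let Lg := 81 * Th ^+ 2 * k ^+ 2.
Let BG := 4 * k * M.
Let Cg := 2 * sqnorm (DH 0) + 18 * Th ^+ 2 * BG.

Let th0 : 0 < th. Proof. exact: (cd_lower_gt0 HA). Qed.
Let Th0 : 0 < Th. Proof. exact: (cd_upper_gt0 HA). Qed.

Lemma G_bounded x : sqnorm (G x) <= BG.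
Proof. exact: field_bounded k0 vcx vM x. Qed.

Lemma DH_bounded p : sqnorm (DH p) <= 2 * sqnorm (DH 0) + 18 * Th ^+ 2 * sqnorm p.
Proof.
have -> : DH p = DH 0 + (DH p - DH 0) by rewrite [RHS]addrC subrK.
apply: le_trans (sqnormD_le _ _) _.
by have := DH_lipschitz HA p 0; rewrite subr0; lra.
Qed.

Lemma speed_bounded x : sqnorm (DH (G x)) <= Cg.
Proof.
apply: le_trans (DH_bounded _) _; rewrite lerD2l ler_pM2l ?G_bounded //.
by rewrite mulr_gt0 // exprn_gt0.
Qed.

Lemma speed_lipschitz x y :
  sqnorm (DH (G x) - DH (G y)) <= Lg * sqnorm (x - y).
Proof.
apply: le_trans (DH_lipschitz HA _ _) _.
have := field_lipschitz k0 vcx vcv x y => h.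
have : 9 * Th ^+ 2 * sqnorm (G x - G y) <= 9 * Th ^+ 2 * (9 * k ^+ 2 * sqnorm (x - y)).
  by rewrite ler_pM2l // mulr_gt0 // exprn_gt0.
by rewrite /Lg; lra.
Qed.

Definition action p t : R := t * (H p - inner p (DH p)).

(** With p' the slope at the moved point, both brackets are quadratically small;
    this is why the value transported by the characteristics has slope p. *)
Lemma characteristic_identity y y' t t' :
  let p := G y in let p' := G y' in
  let x := y - t *: DH p in let x' := y' - t' *: DH p' in
  (v y' + action p' t') - (v y + action p t) - inner p (x' - x) - H p * (t' - t)
  = (v y' - v y - inner p (y' - y))
    + t' * (H p' - H p - inner (p' - p) (DH p')).
Proof. by move=> p p' x x'; rewrite /action /x /x' !inner_lin; ring. Qed.

Variable h : R.
Hypothesis h0 : 0 < h.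
Hypothesis hLg : h ^+ 2 * Lg <= 12^-1.

Let in_time t : `|t| <= h -> t ^+ 2 * Lg <= 12^-1.
Proof.
move=> th'; apply: le_trans hLg; apply: ler_wpM2r.
  by rewrite /Lg; apply: mulr_ge0; [apply: mulr_ge0|]; rewrite ?sqr_ge0 ?ler0n.
by rewrite -real_normK ?num_real // lerXn2r ?nnegrE ?normr_ge0 // ltW.
Qed.

Lemma foot_exists : exists Y : 'rV[R]_d -> R -> 'rV[R]_d,
  forall x t, `|t| <= h -> Y x t = x + t *: DH (G (Y x t)).
Proof.
have ex x t : exists y, `|t| <= h -> y = x + t *: DH (G y).
  have [/in_time tL|] := boolP (`|t| <= h); last by exists 0.
  have [|||y yE] := @contraction_fixpoint Cg Lg t (fun y => DH (G y)) x.
  - exact: speed_bounded.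
  - exact: speed_lipschitz.
  - by apply: le_lt_trans tL _; lra.
  by exists y.
pose Y x t := projT1 (cid (ex x t)).
by exists Y => x t tE; exact: projT2 (cid (ex x t)) tE.
Qed.

Variable Y : 'rV[R]_d -> R -> 'rV[R]_d.
Hypothesis YE : forall x t, `|t| <= h -> Y x t = x + t *: DH (G (Y x t)).

Lemma foot_lipschitz x t x' t' : `|t| <= h -> `|t'| <= h ->
  sqnorm (Y x' t' - Y x t) <= 6 * (sqnorm (x' - x) + Cg * (t' - t) ^+ 2).
Proof.
move=> tE tE'.
set y := Y x t; set y' := Y x' t'.
have yE : y' - y = (x' - x) + (t' *: (DH (G y') - DH (G y)) + (t' - t) *: DH (G y)).
  have Ey : y = x + t *: DH (G y) := YE x tE.
  have Ey' : y' = x' + t' *: DH (G y') := YE x' tE'.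
  rewrite {1}Ey' {1}Ey scalerBr scalerBl.
  by apply/rowP => i; rewrite !mxE; ring.
have h1 := speed_lipschitz y' y; have h2 := speed_bounded y.
have h3 := in_time tE'.
set a := x' - x in yE; set b := DH (G y') - DH (G y) in yE h1.
have e1 : sqnorm (y' - y) <= 3 * sqnorm a + 3 * (t' ^+ 2 * sqnorm b)
    + 3 * ((t' - t) ^+ 2 * sqnorm (DH (G y))).
  by rewrite yE -!sqnormZ; exact: sqnormD3_le.
have e2 : t' ^+ 2 * sqnorm b <= 12^-1 * sqnorm (y' - y).
  apply: (@le_trans _ _ (t' ^+ 2 * (Lg * sqnorm (y' - y)))).
    by rewrite ler_wpM2l ?sqr_ge0.
  by rewrite mulrA ler_wpM2r // sqnorm_ge0.
have e3 : (t' - t) ^+ 2 * sqnorm (DH (G y)) <= (t' - t) ^+ 2 * Cg.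
  by rewrite ler_wpM2l ?sqr_ge0.
have := sqnorm_ge0 a; have := sqr_ge0 (t' - t); have := sqnorm_ge0 (y' - y).
have : 0 <= (t' - t) ^+ 2 * Cg.
  by apply: le_trans e3; rewrite mulr_ge0 ?sqr_ge0 ?sqnorm_ge0.
by lra.
Qed.

Lemma foot0 x : Y x 0 = x.
Proof. by rewrite YE ?scale0r ?addr0 // normr0 ltW. Qed.

(** The value of [v] at the foot of the characteristic through [x] plus the
    action accumulated along it; [Y x t] is this foot. *)
Definition transported x t : R := v (Y x t) + action (G (Y x t)) t.

Lemma transported0 x : transported x 0 = v x.
Proof. by rewrite /transported /action foot0 mul0r addr0. Qed.

Lemma transportedE x t x' t' : `|t| <= h -> `|t'| <= h ->
  let y := Y x t in let y' := Y x' t' in let p := G y in let p' := G y' in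
  transported x' t' - transported x t - inner p (x' - x) - H p * (t' - t)
  = (v y' - v y - inner p (y' - y))
    + t' * (H p' - H p - inner (p' - p) (DH p')).
Proof.
move=> tE tE' y y' p p'.
have yE : x = y - t *: DH p by rewrite {1}/y (YE x tE) addrK.
have yE' : x' = y' - t' *: DH p' by rewrite {1}/y' (YE x' tE') addrK.
have := characteristic_identity y y' t t'; rewrite /= -/p -/p' -yE -yE' => <-.
by rewrite /transported.
Qed.

(** [H p' - H p - <p' - p, DH p'>] is minus a Bregman divergence. *)
Lemma bregman_bounds p p' :
  - (Th / 2 * sqnorm (p' - p)) <= H p' - H p - inner (p' - p) (DH p') <= 0.
Proof.
have pE : p = p' + (p - p') by rewrite [RHS]addrC subrK.
have := cd_convex HA p' (p - p'); have := cd_upper HA p' (p - p').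
rewrite -pE -(sqnormN (p - p')) opprB innerC.
have -> : inner (p - p') (DH p') = - inner (p' - p) (DH p') by rewrite -innerNl opprB.
have : 0 <= th * sqnorm (p' - p) by rewrite mulr_ge0 ?sqnorm_ge0 // ltW.
by move=> h1 h2 h3; apply/andP; split; lra.
Qed.

Lemma transported_expansion x t x' t' : `|t| <= h -> `|t'| <= h ->
  `|transported x' t' - transported x t - inner (G (Y x t)) (x' - x)
    - H (G (Y x t)) * (t' - t)|
  <= (k / 2 + h * (Th / 2 * (9 * k ^+ 2))) *
     (6 * (sqnorm (x' - x) + Cg * (t' - t) ^+ 2)).
Proof.
move=> tE tE'; rewrite transportedE //.
set y := Y x t; set y' := Y x' t'.
apply: (@le_trans _ _ ((k / 2 + h * (Th / 2 * (9 * k ^+ 2))) * sqnorm (y' - y))); last first.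
  apply: ler_wpM2l; last exact: foot_lipschitz.
  by rewrite addr_ge0 ?mulr_ge0 ?sqr_ge0 // ltW.
have hv : `|v y' - v y - inner (G y) (y' - y)| <= k / 2 * sqnorm (y' - y).
  have := vcx y (y' - y); have := vcv y (y' - y).
  have -> : y + (y' - y) = y' by rewrite addrC subrK.
  by move=> h1 h2; apply/ler_normlP; split; lra.
have hq := field_lipschitz k0 vcx vcv y' y.
have /andP[hB1 hB2] := bregman_bounds (G y) (G y').
have hB : `|H (G y') - H (G y) - inner (G y' - G y) (DH (G y'))|
    <= Th / 2 * (9 * k ^+ 2 * sqnorm (y' - y)).
  have : Th / 2 * sqnorm (G y' - G y) <= Th / 2 * (9 * k ^+ 2 * sqnorm (y' - y)).
    by rewrite ler_pM2l // divr_gt0.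
  by move=> h1; apply/ler_normlP; split; lra.
apply: le_trans (ler_normD _ _) _; rewrite normrM mulrDl lerD //.
rewrite -!mulrA; apply: ler_pM => //; by move: hB; rewrite !mulrA.
Qed.

End Characteristics.

(** * One time step *)

Section OneStep.
Context {R : realType} {d : nat}.
Implicit Types (e p q x y : 'rV[R]_d).

Lemma locally_usc_of_gradient (Ham : 'rV[R]_d -> R) (D : 'rV[R]_d -> 'rV[R]_d)
    (a b T : R) : 0 <= b -> 0 < T ->
  (forall p q, Ham (p + q) <= Ham p + inner (D p) q + T / 2 * sqnorm q) ->
  (forall p, sqnorm (D p) <= a + b * sqnorm p) -> locally_usc Ham.
Proof.
move=> b0 T0 HamD Dab B eta eta0.
pose c := `|a + b * B| + 1.
have c0 : 0 < c by rewrite ltr_wpDl.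
pose sg := eta / 2 / c.
have sg0 : 0 < sg by rewrite !divr_gt0.
exists (Num.min (sg * (eta / 2)) (eta / T)).
  by rewrite lt_min mulr_gt0 ?divr_gt0.
move=> p q pB; rewrite le_min => /andP[q1 q2].
have := inner_young (D p) q sg0.
have : sg * sqnorm (D p) <= eta / 2.
  have -> : eta / 2 = sg * c by rewrite /sg divfK // gt_eqF.
  rewrite ler_pM2l // (le_trans (Dab p)) //.
  apply: le_trans (_ : a + b * B <= _); first by rewrite lerD2l ler_wpM2l.
  by rewrite /c; have := ler_norm (a + b * B); lra.
have : sg^-1 * sqnorm q <= eta / 2 by rewrite ler_pdivrMl.
have : T * sqnorm q <= eta by move: q2; rewrite ler_pdivlMr // mulrC.
by have := HamD p q; lra.
Qed.

Section Evolution.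
Variables (H : 'rV[R]_d -> R) (DH : 'rV[R]_d -> 'rV[R]_d).
Variables (A : 'rV[R]_d -> 'M[R]_d) (th Th : R).
Hypothesis HA : convex_data H DH A th Th.

Let th0 : 0 < th. Proof. exact: (cd_lower_gt0 HA). Qed.
Let Th0 : 0 < Th. Proof. exact: (cd_upper_gt0 HA). Qed.

Lemma hamiltonian_locally_usc : locally_usc H.
Proof.
apply: (@locally_usc_of_gradient _ DH _ (18 * Th ^+ 2) Th) => //.
- by rewrite mulr_ge0 ?sqr_ge0.
- exact: (cd_upper HA).
- by move=> p; exact: DH_bounded HA p.
Qed.

Lemma reflected_hamiltonian_locally_usc : locally_usc (fun p => - H (- p)).
Proof.
apply: (@locally_usc_of_gradient _ (fun p => DH (- p)) (2 * sqnorm (DH 0)) (18 * Th ^+ 2) Th) => //.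
- by rewrite mulr_ge0 ?sqr_ge0.
- move=> p q; have := cd_convex HA (- p) (- q); rewrite innerNr sqnormN -opprD.
  have : 0 <= th * sqnorm q by rewrite mulr_ge0 ?sqnorm_ge0 // ltW.
  have : 0 <= Th * sqnorm q by rewrite mulr_ge0 ?sqnorm_ge0 // ltW.
  by lra.
- by move=> p; rewrite -(sqnormN p); exact: DH_bounded HA (- p).
Qed.

Variables (v : 'rV[R]_d -> R) (G : 'rV[R]_d -> 'rV[R]_d) (k M : R).
Hypotheses (k0 : 0 < k) (vM : forall x, `|v x| <= M).
Hypotheses (vcx : semiconvex_along v G k) (vcv : semiconcave_along v G k).
Variable h : R.
Hypothesis h0 : 0 < h.
Hypothesis hLg : h ^+ 2 * (81 * Th ^+ 2 * k ^+ 2) <= 12^-1.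
Hypothesis hsup : h * k * (9 * Th ^+ 2) <= th.

Variable Y : 'rV[R]_d -> R -> 'rV[R]_d.
Hypothesis YE : forall x t, `|t| <= h -> Y x t = x + t *: DH (G (Y x t)).

Local Notation w := (transported H DH v G Y).
Let Cg := 2 * sqnorm (DH 0) + 18 * Th ^+ 2 * (4 * k * M).

Let Cg0 : 0 <= Cg.
Proof. by apply: le_trans (speed_bounded HA k0 vM vcx 0); exact: sqnorm_ge0. Qed.

Let foot_lip := foot_lipschitz HA k0 vM vcx vcv h0 hLg YE.
Let wE := @transportedE _ _ H DH v G h Y YE.

Lemma transported_classical (s : R) :
  classical_solution_on H (fun z => w z.1 (z.2 - s)) (slab s h).
Proof.
pose c := k / 2 + h * (Th / 2 * (9 * k ^+ 2)).
have c0 : 0 <= c by rewrite addr_ge0 ?mulr_ge0 ?sqr_ge0 // ltW.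
exists (4 * k * M), (c * (6 * (1 + Cg))); split.
  by do 2 apply: mulr_ge0 => //; apply: addr_ge0.
move=> z /andP[z1 z2]; exists (G (Y z.1 (z.2 - s))).
  exact: G_bounded k0 vM vcx _.
move=> z' /andP[z1' z2'].
have tE : `|z.2 - s| <= h by rewrite ger0_norm; lra.
have tE' : `|z'.2 - s| <= h by rewrite ger0_norm; lra.
have := transported_expansion HA k0 vM vcx vcv h0 hLg YE z.1 z'.1 tE tE'.
have -> : z'.2 - s - (z.2 - s) = z'.2 - z.2 by ring.
move/le_trans; apply; rewrite -/c -/Cg -mulrA; apply: ler_wpM2l => //.
have := sqnorm_ge0 (z'.1 - z.1); have := sqr_ge0 (z'.2 - z.2).
set a := sqnorm _; set b := _ ^+ 2 => b0 a0.
have : 0 <= Cg * a by rewrite mulr_ge0.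
clearbody Cg.
by lra.
Qed.

Lemma transported_bounded : exists M', forall x t, `|t| <= h -> `|w x t| <= M'.
Proof.
exists (M + h * (`|H 0| + Th / 2 * (4 * k * M))) => x t tE.
rewrite /transported; apply: le_trans (ler_normD _ _) _; apply: lerD => //.
rewrite /action normrM; apply: ler_pM => //.
set p := G _; have pB : sqnorm p <= 4 * k * M by exact: G_bounded k0 vM vcx _.
have /andP[] := bregman_bounds HA 0 p; rewrite subr0 => b1 b2.
have : Th / 2 * sqnorm p <= Th / 2 * (4 * k * M) by rewrite ler_pM2l // divr_gt0.
have n1 := ler_norm (H 0); have n2 := ler_norm (- H 0); rewrite normrN in n2.
have : 0 <= Th / 2 * sqnorm p by rewrite mulr_ge0 ?sqnorm_ge0 // divr_ge0 // ltW.
by move=> h1 h2; apply/ler_normlP; split; lra.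
Qed.

(** The transported function solves the equation in the classical sense, so
    comparison bounds [u] from above; comparison for [- u] and [- H (- p)] bounds it
    from below. *)
Lemma solution_eq_transported (u : 'rV[R]_d * R -> R) (s Mu : R) : 0 <= s ->
  (forall z, closed_half_space z -> `|u z| <= Mu) ->
  {within closed_half_space, continuous u} ->
  paraboloid_subsolution H u ->
  paraboloid_subsolution (fun p => - H (- p)) (fun z => - u z) ->
  (forall x, u (x, s) = v x) ->
  forall x t, 0 <= t <= h / 2 -> u (x, s + t) = w x t.
Proof.
move=> s0 uM uc usub usup us x t tI.
have [Mw wM] := transported_bounded.
have wM' z : slab s h z -> `|w z.1 (z.2 - s)| <= Mw.
  by move=> /andP[z1 z2]; apply: wM; rewrite ger0_norm; lra.
have uM' z : slab s h z -> `|u z| <= Mu.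
  by move=> /andP[z1 z2]; apply: uM; rewrite /closed_half_space /=; lra.
have tI' : s <= s + t <= s + h / 2 by lra.
have stE : s + t - s = t by ring.
apply/le_anti/andP; split.
- have := @comparison _ _ H u (fun z => w z.1 (z.2 - s)) s h (Mu + Mw) s0 h0
    hamiltonian_locally_usc usub uc (transported_classical s).
  move=> /(_ _ _ x (s + t) tI') /=; rewrite stE; apply.
    move=> z Sz; have /ler_normlP[_ h1] := uM' z Sz.
    by have /ler_normlP[h2 _] := wM' z Sz; lra.
  by move=> y; rewrite subrr us (transported0 H v h0 YE).
- have wsol : classical_solution_on (fun p => - H (- p))
      (fun z => - w z.1 (z.2 - s)) (slab s h).
    have [B [L [L0 sol]]] := transported_classical s.
    exists B, L; split=> // z Sz; have [p pB hp] := sol z Sz.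
    exists (- p); first by rewrite sqnormN.
    move=> z' Sz'; rewrite (opprK p) innerNl; apply: le_trans (hp z' Sz').
    rewrite -[leLHS]normrN le_eqVlt; apply/orP; left; apply/eqP; congr `|_|; ring.
  have uc' : {within closed_half_space, continuous (fun z => - u z)}.
    by move=> z; apply: continuous_atN; exact: uc.
  have := @comparison _ _ _ _ _ s h (Mu + Mw) s0 h0
    reflected_hamiltonian_locally_usc usup uc' wsol.
  move=> /(_ _ _ x (s + t) tI') /=; rewrite stE lerN2; apply.
    move=> z Sz; have /ler_normlP[h1 _] := uM' z Sz.
    by have /ler_normlP[_ h2] := wM' z Sz; lra.
  by move=> y; rewrite subrr us (transported0 H v h0 YE).
Qed.

(** The Hopf-Lax inequality, in terms of slopes instead of the Legendre dual. *)
Lemma transported_ge t y q : 0 <= t <= h ->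
  v y + action H DH q t <= w (y - t *: DH q) t.
Proof.
move=> /andP[t0 th'].
have tE : `|t| <= h by rewrite ger0_norm.
rewrite /transported.
set x := y - t *: DH q; set y' := Y x t; set p' := G y'.
have yy : y = y' + t *: (DH q - DH p').
  have : y' = x + t *: DH p' by exact: YE.
  by move=> ->; rewrite /x scalerBr; apply/rowP => i; rewrite !mxE; ring.
have := vcv y' (t *: (DH q - DH p')); rewrite -yy -/p' innerZr sqnormZ innerDr innerNr.
have := cd_convex HA q (p' - q).
have -> : q + (p' - q) = p' by rewrite addrC subrK.
have := DH_lipschitz HA q p'.
rewrite -(sqnormN (p' - q)) opprB innerDr innerNr !(innerC (DH q)).
rewrite /action; set n := sqnorm (q - p'); set D := sqnorm _.
set a := inner p' (DH q); set b := inner q (DH q); set c := inner p' (DH p').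
move=> hD hH hv.
have n0 : 0 <= n by exact: sqnorm_ge0.
have : t * (k * (9 * Th ^+ 2) * n * t) <= t * (th * n).
  apply: ler_wpM2l => //.
  have : t * (k * (9 * Th ^+ 2) * n) <= h * (k * (9 * Th ^+ 2) * n).
    by apply: ler_wpM2r => //; rewrite !mulr_ge0 ?sqr_ge0 // ltW.
  have : h * k * (9 * Th ^+ 2) * n <= th * n by apply: ler_wpM2r.
  by lra.
have : t ^+ 2 * k * D <= t ^+ 2 * k * (9 * Th ^+ 2 * n).
  by apply: ler_wpM2l => //; rewrite mulr_ge0 ?sqr_ge0 // ltW.
have : t * (H q + (a - b) - - th / 2 * n) <= t * H p' by apply: ler_wpM2l.
by rewrite !expr2; lra.
Qed.

Lemma transported_semiconvex k' t : 0 <= t <= h ->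
  semiconvex_along v G k' ->
  semiconvex_along (fun x => w x t) (fun x => G (Y x t)) k'.
Proof.
move=> tI vk' x e.
have tE : `|t| <= h by have /andP[? ?] := tI; rewrite ger0_norm.
set y := Y x t; set p := G y.
have -> : x + e = (y + e) - t *: DH p.
  have : y = x + t *: DH p by exact: YE.
  by move=> ->; apply/rowP => i; rewrite !mxE; ring.
apply: le_trans (transported_ge _ _ tI).
by have := vk' y e; rewrite /transported -/y -/p; lra.
Qed.

(** Insert the expansions of [v] at the foot and of [H] at the slope in
    [transportedE]: the leading terms are half the left side of [riccati_le], with [x]
    the displacement of the foot and [y] the image under [A p] of the change of
    slope, and [x - t *: y] is the displacement [e] up to a small error. *)
Lemma transported_hessian_le K t : 0 < K -> 0 <= t <= h -> 0 < 1 - K * t ->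
  hessian_le v G (fun p e => K * inv_form A p e) ->
  hessian_le (fun x => w x t) (fun x => G (Y x t))
    (fun p e => K / (1 - K * t) * inv_form A p e).
Proof.
move=> K0 tI Kt vK x eps eps0.
have /andP[t0 t1] := tI.
have tE : `|t| <= h by rewrite ger0_norm.
set y := Y x t; set p := G y; set K' := K / _.
have K'0 : 0 < K' by rewrite divr_gt0.
pose c := 54 * k ^+ 2.
have c0 : 0 <= c by rewrite mulr_ge0 ?sqr_ge0.
(* 54 = 6 * 9 combines the Lipschitz bounds of the foot and of the slope; [C]
   collects the errors of the expansions, each taken with precision [ep]. *)
pose C := 6 + t * (2 * c) + K' / 2 * (t * (1 + c) + t ^+ 2 * c) / th.
have C0 : 0 <= C.
  have h1 : 0 <= t * (2 * c) by rewrite mulr_ge0 // mulr_ge0.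
  have h2 : 0 <= t * (1 + c) by rewrite mulr_ge0 // addr_ge0.
  have h3 : 0 <= t ^+ 2 * c by rewrite mulr_ge0 ?sqr_ge0.
  rewrite /C; apply: addr_ge0; first by lra.
  apply: divr_ge0; last exact: ltW.
  by apply: mulr_ge0; [rewrite divr_ge0 // ltW|exact: addr_ge0].
pose ep := Num.min 1 (eps / (C + 1)).
have C1 : 0 < C + 1 by rewrite ltr_wpDl.
have ep0 : 0 < ep by rewrite lt_min ltr01 divr_gt0.
have ep1 : ep <= 1 by rewrite ge_min lexx.
have epC : ep * C <= eps.
  have : ep <= eps / (C + 1) by rewrite ge_min lexx orbT.
  by rewrite ler_pdivlMr // mulrDr mulr1; lra.
have [r1 r10 hv] := vK y ep ep0.
have [r2 r20 hD] := cd_taylor1 HA p (exprn_gt0 2 ep0).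
have [r3 r30 hH] := cd_taylor2 HA p ep0.
exists (Num.min (r1 / 6) (Num.min r2 r3 / (c + 1))).
  by rewrite lt_min !divr_gt0 // ?lt_min ?r20 ?r30 // ltr_wpDl.
move=> e; rewrite lt_min !ltr_pdivlMr ?ltr_wpDl // => /andP[er1].
rewrite lt_min => /andP[er2 er3].
set y' := Y (x + e) t; set p' := G y'; set q := p' - p; set z := y' - y.
have xe : x + e - x = e by rewrite addrAC subrr add0r.
have zb : sqnorm z <= 6 * sqnorm e.
  have := foot_lip x (x + e) tE tE; rewrite xe subrr expr0n /= mulr0 addr0.
  by [].
have qb : sqnorm q <= c * sqnorm e.
  apply: le_trans (field_lipschitz k0 vcx vcv y' y) _; rewrite -/z.
  have : 9 * k ^+ 2 * sqnorm z <= 9 * k ^+ 2 * (6 * sqnorm e).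
    by rewrite ler_wpM2l // mulr_ge0 ?sqr_ge0.
  by rewrite /c; lra.
have e0 := sqnorm_ge0 e.
have zr : sqnorm z < r1 by lra.
have qr2 : sqnorm q < r2 by rewrite mulrDr mulr1 in er2; lra.
have qr3 : sqnorm q < r3 by rewrite mulrDr mulr1 in er3; lra.
have yz : y + z = y' by rewrite /z addrC subrK.
have pq : p + q = p' by rewrite /q addrC subrK.
have {}hv := hv z zr; rewrite yz -/p in hv.
have {}hH := hH q qr3; rewrite pq in hH.
have {}hD := hD q qr2; rewrite pq in hD.
have [r rE] : exists r, r = DH p' - DH p - q *m A p by exists (DH p' - DH p - q *m A p).
rewrite -rE in hD.
have ze : z - t *: (q *m A p) = e + t *: r.
  have Ey : y = x + t *: DH p by exact: YE.
  have Ey' : y' = x + e + t *: DH p' by exact: YE.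
  rewrite /z Ey' Ey rE; apply/rowP => i; rewrite !mxE; ring.
have invs : (invmx (A p))^T = invmx (A p) by apply: trmx_invmx; exact: (cd_sym HA).
have := @riccati_le _ _ (invmx (A p)) K t z (q *m A p) invs (inv_form_ge0 HA p) K0 t0 Kt.
rewrite -/K' -!/(inv_form A p _) (inv_form_mulmx HA) ze.
have inv_er : inv_form A p (e + t *: r) = inv_form A p e
    + 2 * t * inner (e *m invmx (A p)) r + t ^+ 2 * inv_form A p r.
  rewrite /inv_form mulmxDl -scalemxAl !inner_lin.
  rewrite (inner_mulmx r _ e) invs (innerC r); ring.
have young : 2 * inner (e *m invmx (A p)) r <= ep * inv_form A p e + ep^-1 * inv_form A p r.
  have : 0 <= inv_form A p (ep *: e - r) by exact: inv_form_ge0 HA _ _.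
  rewrite /inv_form mulmxBl -scalemxAl !inner_lin (inner_mulmx r _ e) invs (innerC r).
  set a := inner _ e; set b := inner _ r; set c' := inner (r *m _) r => h1.
  rewrite -(ler_pM2l ep0) mulrDr (mulrA ep ep^-1) divff ?gt_eqF // mul1r.
  by lra.
have fe := inv_form_le HA p e; have fr := inv_form_le HA p r.
have DHp : inner q (DH p') = inner (DH p) q + inner (q *m A p) q + inner q r.
  have -> : DH p' = DH p + q *m A p + r by rewrite rE; apply/rowP => i; rewrite !mxE; ring.
  by rewrite 2!(innerDr _ _ q) (innerC q (DH p)) (innerC q (q *m A p)).
have qyoung : 2 * - inner q r <= ep * sqnorm q + ep^-1 * sqnorm r.
  by rewrite -innerNl -(sqnormN q); exact: inner_young.
have wE' : w (x + e) t = w x t + inner p e + (v y' - v y - inner p z)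
    + t * (H p' - H p - inner q (DH p')).
  have := wE x (x + e) tE tE.
  by rewrite /= -/y -/y' -/p -/p' xe subrr mulr0 subr0 -/z -/q; lra.
rewrite wE' inv_er DHp => ric; move: hv hH fe fr young qyoung hD.
clear wE' inv_er DHp; rewrite -/p.
set a := inner p z; set b := inner (DH p) q; set c1 := inner (q *m A p) q in ric *.
set ie := inv_form A p e in ric *; set iz := inv_form A p z in ric *.
set ir := inv_form A p r in ric *; set m := inner (e *m _) r in ric *.
set qr := inner q r; set ne := sqnorm e in zb qb e0 *; set nz := sqnorm z in zb *.
set nq := sqnorm q in qb *; set nr := sqnorm r; set nn := inner p e.
set V := v y'; set W := v y; set H1 := H p'; set H2 := H p.
move=> hv hH fe fr young qyoung hD.
have nq0 : 0 <= nq by exact: sqnorm_ge0.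
have nqc : ep * nq <= ep * (c * ne) by rewrite ler_pM2l.
have nzc : ep * nz <= ep * (6 * ne) by rewrite ler_pM2l.
have irb : ep^-1 * ir <= th^-1 * (ep * (c * ne)).
  rewrite ler_pdivrMl //; apply: le_trans fr _.
  have -> : ep * (th^-1 * (ep * (c * ne))) = th^-1 * (ep ^+ 2 * (c * ne)) by ring.
  rewrite ler_pM2l ?invr_gt0 //; apply: le_trans hD _.
  by rewrite ler_pM2l // exprn_gt0.
have ir2 : ir <= th^-1 * (ep * (c * ne)).
  move: irb; rewrite ler_pdivrMl // => h1; apply: le_trans h1 _.
  rewrite -[leRHS]mul1r; apply: ler_wpM2r => //.
  apply: mulr_ge0; first by rewrite invr_ge0 ltW.
  by apply: mulr_ge0; [exact: ltW|exact: mulr_ge0].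
have m2 : 2 * m <= th^-1 * (ep * ((1 + c) * ne)).
  have : ep * ie <= ep * (th^-1 * ne) by rewrite ler_pM2l.
  by move: young irb; lra.
have tm : t * (2 * m) <= t * (th^-1 * (ep * ((1 + c) * ne))) by apply: ler_wpM2l.
have tir : t ^+ 2 * ir <= t ^+ 2 * (th^-1 * (ep * (c * ne))).
  by apply: ler_wpM2l => //; exact: sqr_ge0.
have K'm : K' * (t * (2 * m) + t ^+ 2 * ir) <=
   K' * (t * (th^-1 * (ep * ((1 + c) * ne))) + t ^+ 2 * (th^-1 * (ep * (c * ne)))).
  by rewrite ler_pM2l // lerD.
have qr1 : - qr <= ep * nq.
  have : ep^-1 * nr <= ep * nq by rewrite ler_pdivrMl // mulrA -expr2.
  by move: qyoung; lra.
have tH : t * (H1 - H2 - (b + c1 + qr)) <= t * (- c1 / 2 + 2 * (ep * (c * ne))).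
  by apply: ler_wpM2l => //; lra.
have epCn : ep * C * ne <= eps * ne by apply: ler_wpM2r.
have CE : ep * C * ne = ep * (6 * ne) + t * (2 * (ep * (c * ne)))
  + K' * (t * (th^-1 * (ep * ((1 + c) * ne))) + t ^+ 2 * (th^-1 * (ep * (c * ne)))) / 2.
  by rewrite /C; field; rewrite gt_eqF.
by lra.
Qed.

End Evolution.
End OneStep.

(** * Iteration of the time step *)

Section Propagation.
Context {R : realType} {d : nat}.
Implicit Types (e p q x y : 'rV[R]_d).

Lemma slice_continuous (u : 'rV[R]_d * R -> R) s : 0 <= s ->
  {within closed_half_space, continuous u} -> continuous (fun x => u (x, s)).
Proof.
move=> s0 /subspace_continuousP uc x.
have cu := uc (x, s) s0.
apply: (cvg_comp _ _ _ cu) => S /= nS.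
have [[U V] /= [nU nV] UVS] := nS.
apply: filterS nU => x' Ux'.
have xs : (U `*` V) (x', s) by split=> //; exact: nbhs_singleton nV.
exact: UVS xs s0.
Qed.

Lemma semiconcave_alongW (v : 'rV[R]_d -> R) G k k' : k <= k' ->
  semiconcave_along v G k -> semiconcave_along v G k'.
Proof.
move=> kk vk y e; apply: le_trans (vk y e) _; rewrite lerD2l ler_wpM2r ?sqnorm_ge0 //.
by lra.
Qed.

Lemma semiconvex_alongW (v : 'rV[R]_d -> R) G k k' : k <= k' ->
  semiconvex_along v G k -> semiconvex_along v G k'.
Proof.
move=> kk vk y e; apply: le_trans (vk y e).
by rewrite lerD2l lerN2 ler_wpM2r ?sqnorm_ge0 //; lra.
Qed.

(** Given [H], the admissible length of a time step depends on the Lipschitz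
    constant of the slopes only. This constant stays bounded up to time [t]: the
    semiconvexity constant is preserved, and the semiconcavity constant is at most
    [K / th] as long as the inverse Hessian form is bounded by [K]. So finitely many
    equal steps reach [t], and [K / (1 - K tau)] iterates to [C / (1 - C t)]. *)
Theorem inverse_hessian_bound_propagates (H : 'rV[R]_d -> R)
    (DH : 'rV[R]_d -> 'rV[R]_d) (A : 'rV[R]_d -> 'M[R]_d) (th Th : R)
    (u : 'rV[R]_d * R -> R) (G0 : 'rV[R]_d -> 'rV[R]_d) (k0 Mu C t : R) :
  convex_data H DH A th Th ->
  (forall z, closed_half_space z -> `|u z| <= Mu) ->
  {within closed_half_space, continuous u} ->
  paraboloid_subsolution H u ->
  paraboloid_subsolution (fun p => - H (- p)) (fun z => - u z) ->
  semiconvex_along (fun x => u (x, 0)) G0 k0 ->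
  hessian_le (fun x => u (x, 0)) G0 (fun p e => C * inv_form A p e) ->
  0 < C -> 0 < t -> 0 < 1 - C * t ->
  exists G k, semiconvex_along (fun x => u (x, t)) G k /\
    hessian_le (fun x => u (x, t)) G (fun p e => C / (1 - C * t) * inv_form A p e).
Proof.
move=> HA uM uc usub usup vcx vhess C0 t0 Ct.
have th0 := cd_lower_gt0 HA; have Th0 := cd_upper_gt0 HA.
pose k := Num.max k0 (C / (1 - C * t) / th).
have kth0 : 0 < C / (1 - C * t) / th by rewrite !divr_gt0.
have kp : 0 < k by rewrite lt_max kth0 orbT.
(* The three bounds serve the construction of the characteristics (the first
   turns the condition on [h ^+ 2] into one on [h]) and the Hopf-Lax inequality. *)
pose h := Num.min 1 (Num.min (12 * (81 * Th ^+ 2 * k ^+ 2))^-1 (th / (k * (9 * Th ^+ 2)))).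
have T2 : 0 < Th ^+ 2 by rewrite exprn_gt0.
have k2 : 0 < k ^+ 2 by rewrite exprn_gt0.
have a0 : 0 < 81 * Th ^+ 2 * k ^+ 2 by do 2 rewrite mulr_gt0 //.
have b0 : 0 < k * (9 * Th ^+ 2) by rewrite mulr_gt0 // mulr_gt0.
have h0 : 0 < h.
  by rewrite !lt_min ltr01 invr_gt0 mulr_gt0 //= divr_gt0.
have h1 : h <= 1 by rewrite ge_min lexx.
have hLg : h ^+ 2 * (81 * Th ^+ 2 * k ^+ 2) <= 12^-1.
  have : h <= (12 * (81 * Th ^+ 2 * k ^+ 2))^-1 by rewrite !ge_min lexx orbT.
  rewrite -[X in _ <= X]mul1r ler_pdivlMr ?mulr_gt0 // => hh.
  have : h ^+ 2 * (81 * Th ^+ 2 * k ^+ 2) <= h * (81 * Th ^+ 2 * k ^+ 2).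
    by rewrite ler_pM2r // expr2 -[leRHS]mulr1 ler_pM2l.
  by lra.
have hsup : h * k * (9 * Th ^+ 2) <= th.
  by rewrite -mulrA -ler_pdivlMr // !ge_min lexx !orbT.
pose n := (Num.bound (2 * t / h)).+1.
have n0 : 0 < n%:R :> R by rewrite ltr0n.
pose tau := t / n%:R.
have tau0 : 0 < tau by rewrite divr_gt0.
have tauh : tau <= h / 2.
  have : 2 * t / h < n%:R.
    have th_ge0 : 0 <= 2 * t / h by rewrite divr_ge0 ?ltW // mulr_gt0.
    by apply: lt_le_trans (archi_boundP th_ge0) _; rewrite ler_nat.
  rewrite ltr_pdivrMr // /tau ler_pdivrMr //; lra.
have tn : n%:R * tau = t by rewrite /tau mulrC divfK // gt_eqF.
have jtau j : (j <= n)%N -> j%:R * tau <= t.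
  by move=> jn; rewrite -tn ler_pM2r // ler_nat.
suff step j : (j <= n)%N -> exists G,
    semiconvex_along (fun x => u (x, j%:R * tau)) G k /\
    hessian_le (fun x => u (x, j%:R * tau)) G
      (fun p e => C / (1 - C * (j%:R * tau)) * inv_form A p e).
  by have [G hG] := step n (leqnn n); rewrite tn in hG; exists G, k.
elim: j => [_|j IH jn].
  exists G0; rewrite mul0r mulr0 subr0 divr1; split=> //.
  by apply: semiconvex_alongW vcx; rewrite le_max lexx.
have [G [Gx Gh]] := IH (ltnW jn).
set s := j%:R * tau in Gx Gh.
have s0 : 0 <= s by rewrite mulr_ge0 // ltW.
have sE : j.+1%:R * tau = s + tau by rewrite -natr1 mulrDl mul1r.
have st : s + tau <= t by rewrite -sE; exact: jtau.
have Cst : C * (s + tau) <= C * t by rewrite ler_pM2l.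
have Ctau : 0 < C * tau by rewrite mulr_gt0.
have Cs : 0 < 1 - C * s by rewrite mulrDr in Cst; lra.
set K := C / (1 - C * s) in Gh.
have K0 : 0 < K by rewrite divr_gt0.
have Kk : K / th <= k.
  apply: (@le_trans _ _ (C / (1 - C * t) / th)); last by rewrite le_max lexx orbT.
  rewrite ler_pM2r ?invr_gt0 // ler_pM2l // lef_pV2 ?posrE //.
  by rewrite mulrDr in Cst; lra.
have vc : continuous (fun x => u (x, s)) := slice_continuous s0 uc.
have Gv : semiconcave_along (fun x => u (x, s)) G k.
  apply: semiconcave_alongW Kk _; apply: semiconcave_of_hessian_le vc Gh _ => p e.
  by rewrite -mulrA ler_pM2l //; exact: inv_form_le HA p e.
have vM x : `|u (x, s)| <= Mu by exact: uM.
have [Y YE] := foot_exists HA kp vM Gx Gv h0 hLg.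
have wE := solution_eq_transported HA kp vM Gx Gv h0 hLg YE s0 uM uc usub usup (fun=> erefl).
have tauI : 0 <= tau <= h by lra.
have tauI' : 0 <= tau <= h / 2 by lra.
have uE : (fun x => u (x, s + tau)) = (fun x => transported H DH (fun x => u (x, s)) G Y x tau).
  by apply/funext => x; exact: wE.
have Ktau : 1 - K * tau = (1 - C * (s + tau)) / (1 - C * s).
  by rewrite /K; field; rewrite gt_eqF.
have Ktau0 : 0 < 1 - K * tau by rewrite Ktau divr_gt0 //; lra.
exists (fun x => G (Y x tau)); rewrite sE uE; split.
  exact: (transported_semiconvex HA kp Gv hsup YE tauI Gx).
have -> : C / (1 - C * (s + tau)) = K / (1 - K * tau).
  by rewrite Ktau /K; field; rewrite !gt_eqF //; lra.
by have := transported_hessian_le HA kp vM Gx Gv h0 hLg YE K0 tauI Ktau0 Gh.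
Qed.

End Propagation.

(** * Directional derivatives and functions of class C^k *)

Section DirectionalDerivatives.
Context {R : realType} {V : normedModType R}.
Implicit Types (f g : V -> R) (x v : V).

(** Differentiates polynomials, and restrictions of test functions, by expanding
    them. *)
Lemma is_derive_of_quadratic f x v (b c r : R) : 0 < r ->
  (forall h, `|h| < r -> `|f (h *: v + x) - f x - h * b| <= c * h ^+ 2) ->
  is_derive x v f b.
Proof.
move=> r0 hf.
have lim_b : (h^-1 *: ((f \o shift x) (h *: v) - f x)) @[h --> 0^'] --> b.
  apply/cvgrPdist_lt => eps eps0.
  have c0 : 0 < `|c| + 1 by rewrite ltr_wpDl.
  exists (Num.min r (eps / (`|c| + 1))); first by rewrite /= lt_min r0 divr_gt0.
  move=> h; rewrite /= sub0r normrN lt_min => /andP[hr he] h0.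
  have hn : 0 < `|h| by rewrite normr_gt0.
  rewrite distrC.
  have -> : h^-1 *: (f (h *: v + x) - f x) - b = h^-1 * (f (h *: v + x) - f x - h * b).
    by rewrite -[_ *: _]/(_ * _); field.
  rewrite normrM normfV.
  apply: (@le_lt_trans _ _ (`|c| * `|h|)).
    rewrite ler_pdivrMl //; apply: le_trans (hf h hr) _.
    have -> : `|h| * (`|c| * `|h|) = `|c| * h ^+ 2 by rewrite -real_normK ?num_real //; ring.
    by rewrite ler_wpM2r ?sqr_ge0 // ler_norm.
  have : `|h| * (`|c| + 1) < eps by rewrite -ltr_pdivlMr.
  by rewrite mulrDr mulr1 mulrC; lra.
split; first by apply/cvg_ex; exists b.
exact: cvg_lim.
Qed.

Lemma line_is_derive f x v t : derivable f (x + t *: v) v ->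
  is_derive t 1 (fun s => f (x + s *: v)) ('D_v f (x + t *: v)).
Proof.
have E : (fun h : R => h^-1 *: (((fun s => f (x + s *: v)) \o shift t) (h *: 1) - f (x + t *: v)))
   = (fun h : R => h^-1 *: ((f \o shift (x + t *: v)) (h *: v) - f (x + t *: v))).
  apply/funext => h /=; congr (_ *: (f _ - _)).
  by rewrite -[h *: 1]/(h * 1) mulr1 scalerDl addrCA.
by move=> fd; split; [rewrite /derivable E|rewrite /derive E].
Qed.

Lemma line_mvt f x v s : (forall t, derivable f (x + t *: v) v) ->
  exists2 t, `|t| <= `|s| & f (x + s *: v) - f x = s * 'D_v f (x + t *: v).
Proof.
move=> fd; pose g t := f (x + t *: v).
have gd (t : R) : is_derive t 1 g ('D_v f (x + t *: v)) by exact: line_is_derive.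
have gc (a b : R) : {within `[a, b], continuous g}.
  by apply: derivable_within_continuous => t _; apply: ex_derive.
have g0 : g 0 = f x by rewrite /g scale0r addr0.
have [s0|s0] := leP 0 s.
- have [t tI] := MVT_segment s0 (fun t _ => gd t) (gc _ _).
  rewrite g0 subr0 mulrC => gE; exists t; last exact: gE.
  by move: tI; rewrite in_itv /= => /andP[t0 ts]; rewrite !ger0_norm.
- have [t tI] := MVT_segment (ltW s0) (fun t _ => gd t) (gc _ _).
  rewrite g0 sub0r => gE; exists t.
    by move: tI; rewrite in_itv /= => /andP[t0 ts]; rewrite !ler0_norm ?lerN2 // ltW.
  by rewrite -[LHS]opprB gE mulrN opprK mulrC.
Qed.

Lemma Ck_on_subset (A B : set V) k f : B `<=` A -> Ck_on A k f -> Ck_on B k f.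
Proof.
move=> BA; elim: k f => [|k IH] f /=; first by move=> [cf _]; split=> // x /BA; exact: cf.
move=> [cf df]; split=> [x /BA|v]; first exact: cf.
by have [dv Dv] := df v; split=> [x /BA|]; [exact: dv|exact: IH].
Qed.

Lemma Ck_onW (A : set V) k f : Ck_on A k.+1 f -> Ck_on A k f.
Proof.
elim: k f => [|k IH] f; first by move=> [cf _].
by move=> [cf df]; split=> // v; have [dv /IH Dv] := df v.
Qed.

Lemma smooth_cst (c : R) : smooth (fun _ : V => c).
Proof.
move=> k; elim: k c => [|k IH] c; split=> //; try by move=> x _; exact: cst_continuous.
move=> v; split=> [x _|]; first exact: derivable_cst.
have -> : 'D_v (fun _ : V => c) = (fun _ => 0) by apply/funext => x; exact: derive_cst.
exact: IH.
Qed.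

Lemma smooth_linear (l : V -> R) : continuous l ->
  (forall h v x, l (h *: v + x) = h * l v + l x) -> smooth l.
Proof.
move=> cl lin k; case: k => [|k]; (split; first by move=> x _; exact: cl) => // v.
have dl x : is_derive x v l (l v).
  apply: (@is_derive_of_quadratic _ _ _ _ 0 1) => // h _.
  by rewrite lin addrK subrr normr0 mul0r.
split=> [x _|]; first exact: ex_derive.
have -> : 'D_v l = (fun _ => l v) by apply/funext => x; exact: derive_val.
exact: smooth_cst.
Qed.

Lemma Ck_onD k f g : Ck_on [set: V] k f -> Ck_on [set: V] k g ->
  Ck_on [set: V] k (fun x => f x + g x).
Proof.
elim: k f g => [|k IH] f g [cf df] [cg dg]; split=> //;
  try by move=> x _; apply: continuous_atD; [exact: cf|exact: cg].
move=> v; have [dfv Dfv] := df v; have [dgv Dgv] := dg v; split; first move=> x _.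
  by apply: derivableD; [exact: dfv|exact: dgv].
have -> : 'D_v (fun x => f x + g x) = (fun x => 'D_v f x + 'D_v g x).
  by apply/funext => x; apply: deriveD; [exact: dfv|exact: dgv].
exact: IH.
Qed.

Lemma Ck_onM k f g : Ck_on [set: V] k f -> Ck_on [set: V] k g ->
  Ck_on [set: V] k (fun x => f x * g x).
Proof.
elim: k f g => [|k IH] f g fk gk; have [cf df] := fk; have [cg dg] := gk; split=> //;
  try by move=> x _; apply: continuous_atM; [exact: cf|exact: cg].
move=> v; have [dfv Dfv] := df v; have [dgv Dgv] := dg v; split; first move=> x _.
  by apply: derivableM; [exact: dfv|exact: dgv].
have -> : 'D_v (fun x => f x * g x) = (fun x => f x * 'D_v g x + g x * 'D_v f x).
  by apply/funext => x; apply: deriveM; [exact: dfv|exact: dgv].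
by apply: Ck_onD; apply: IH => //; exact: Ck_onW.
Qed.

Lemma smoothD f g : smooth f -> smooth g -> smooth (fun x => f x + g x).
Proof. by move=> fs gs k; exact: Ck_onD. Qed.

Lemma smoothM f g : smooth f -> smooth g -> smooth (fun x => f x * g x).
Proof. by move=> fs gs k; exact: Ck_onM. Qed.

Lemma smooth_sum (I : Type) (r : seq I) (F : I -> V -> R) :
  (forall i, smooth (F i)) -> smooth (fun x => \sum_(i <- r) F i x).
Proof.
move=> Fs; elim: r => [|i r IH].
  by under eq_fun do rewrite big_nil; exact: smooth_cst.
by under eq_fun do rewrite big_cons; apply: smoothD.
Qed.

End DirectionalDerivatives.

(** * Taylor expansions in finite dimension *)

Section Taylor.
Context {R : realType} {d : nat}.
Implicit Types (f : 'rV[R]_d -> R) (e x y v : 'rV[R]_d).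

Lemma coord_le_norm e i : `|e 0 i| <= `|e|.
Proof.
rewrite [leRHS]/Num.norm /= mx_normrE.
by apply/bigmax_geP; right => /=; exists (0, i).
Qed.

Lemma norm_delta_le (t : R) (i : 'I_d) : `|t *: delta_mx 0 i : 'rV[R]_d| <= `|t|.
Proof.
have := norm_le_sqnorm (t *: delta_mx 0 i : 'rV[R]_d).
rewrite sqnormZ /sqnorm inner_delta mxE !eqxx mulr1 -(real_normK (num_real t)).
by rewrite ler_pXn2r ?nnegrE.
Qed.

Lemma row_sum_coord e : \sum_i e 0 i *: delta_mx 0 i = e.
Proof. by rewrite [RHS]row_sum_delta. Qed.

(** Moving one coordinate at a time reduces the expansion to the mean value
    theorem on the axes. *)
Lemma C1_expansion f x eps : Ck_on [set: 'rV[R]_d] 1 f -> 0 < eps ->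
  exists2 r, 0 < r & forall e, sqnorm e < r ->
    (f (x + e) - f x - inner (grad f x) e) ^+ 2 <= eps * sqnorm e.
Proof.
move=> [_ df] eps0.
pose D (i : 'I_d) := 'D_(delta_mx 0 i) f.
have Dc i : continuous (D i) by move=> y; have [_ [h _]] := df (delta_mx 0 i); exact: h.
have fd i y : derivable f y (delta_mx 0 i) by have [h _] := df (delta_mx 0 i); exact: h.
have d1 : 0 < d%:R + 1 :> R by rewrite ltr_wpDl.
pose eta := Num.sqrt eps / (d%:R + 1).
have eta0 : 0 < eta by rewrite divr_gt0 // sqrtr_gt0.
have : \forall y \near x, forall i, `|D i x - D i y| < eta.
  apply: (@filter_forall _ _ (fun i y => `|D i x - D i y| < eta) (nbhs x)).
  by move=> i; have /cvgrPdist_lt := Dc i x; apply.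
move=> /nbhs_ballP[rho /= rho0 hrho].
have {}hrho y i : `|y - x| < rho -> `|D i y - D i x| < eta.
  move=> yx; rewrite distrC; apply: hrho.
  by rewrite -ball_normE /= distrC.
pose P e (s : seq 'I_d) : 'rV[R]_d := \sum_(i <- s) e 0 i *: delta_mx 0 i.
have Pn e s : `|P e s| <= (size s)%:R * `|e|.
  elim: s => [|i s IH]; first by rewrite /P big_nil normr0 mul0r.
  rewrite /P big_cons /= -natr1 mulrDl mul1r [leRHS]addrC.
  apply: le_trans (ler_normD _ _) _; apply: lerD => //.
  exact: le_trans (norm_delta_le _ _) (coord_le_norm _ _).
have main e s : (size s)%:R * `|e| < rho ->
    `|f (x + P e s) - f x - \sum_(i <- s) e 0 i * D i x| <= (size s)%:R * (eta * `|e|).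
  elim: s => [|i s IH] hs.
    by rewrite /P !big_nil addr0 subrr subr0 normr0 mul0r.
  have hs' : (size s)%:R * `|e| < rho.
    by apply: le_lt_trans hs; apply: ler_wpM2r => //; rewrite ler_nat /=.
  have [t tE fE] := @line_mvt _ _ f (x + P e s) (delta_mx 0 i) (e 0 i) (fun t => fd i _).
  have PE : x + P e (i :: s) = x + P e s + e 0 i *: delta_mx 0 i.
    by rewrite /P big_cons addrCA addrC.
  rewrite PE big_cons /=.
  have -> : f (x + P e s + e 0 i *: delta_mx 0 i) - f x
      - (e 0 i * D i x + \sum_(j <- s) e 0 j * D j x)
    = (f (x + P e s) - f x - \sum_(j <- s) e 0 j * D j x)
      + e 0 i * (D i (x + P e s + t *: delta_mx 0 i) - D i x).
    rewrite mulrBr -fE; ring.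
  apply: le_trans (ler_normD _ _) _.
  rewrite -natr1 mulrDl mul1r; apply: lerD; first exact: IH.
  rewrite normrM mulrC; apply: ler_pM => //; last exact: coord_le_norm.
  apply/ltW/hrho; apply: le_lt_trans hs.
  rewrite -[x + P e s + _]addrA (addrC x) addrK /= -natr1 mulrDl mul1r.
  apply: le_trans (ler_normD _ _) _; apply: lerD => //.
  apply: le_trans (norm_delta_le _ _) _; apply: le_trans tE _.
  exact: coord_le_norm.
exists ((rho / (d%:R + 1)) ^+ 2); first by rewrite exprn_gt0 // divr_gt0.
move=> e er.
have en : `|e| < rho / (d%:R + 1).
  have := le_lt_trans (norm_le_sqnorm e) er.
  by rewrite ltr_pXn2r // nnegrE // ltW // divr_gt0.
have hs : (size (index_enum 'I_d))%:R * `|e| < rho.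
  rewrite ltr_pdivlMr // mulrDr mulr1 in en.
  have -> : size (index_enum 'I_d) = d by rewrite -[RHS]card_ord cardE enumT.
  by rewrite mulrC; apply: le_lt_trans en; rewrite lerDl.
have := main e _ hs; rewrite /P row_sum_coord.
have -> : size (index_enum 'I_d) = d by rewrite -[RHS]card_ord cardE enumT.
have -> : \sum_i e 0 i * D i x = inner (grad f x) e.
  by rewrite inner_sumE; apply: eq_bigr => i _; rewrite mxE mulrC.
set q := _ - inner _ _ => hq.
have hq2 : `|q| <= Num.sqrt eps * `|e|.
  apply: le_trans hq _; rewrite mulrA; apply: ler_wpM2r => //.
  rewrite /eta mulrA ler_pdivrMr // mulrC; apply: ler_wpM2l; first exact: sqrtr_ge0.
  by rewrite lerDl.
rewrite -real_normK ?num_real //.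
apply: (@le_trans _ _ ((Num.sqrt eps * `|e|) ^+ 2)).
  by rewrite lerXn2r ?nnegrE // mulr_ge0 // sqrtr_ge0.
by rewrite exprMn (sqr_sqrtr (ltW eps0)) ler_pM2l // norm_le_sqnorm.
Qed.

Lemma C1_is_derive f x v : Ck_on [set: 'rV[R]_d] 1 f ->
  is_derive x v f (inner (grad f x) v).
Proof.
move=> f1; set b := inner (grad f x) v.
have v1 : 0 < sqnorm v + 1 by rewrite ltr_wpDl ?sqnorm_ge0.
have lim_b : (h^-1 *: ((f \o shift x) (h *: v) - f x)) @[h --> 0^'] --> b.
  apply/cvgrPdist_lt => eps eps0.
  pose e1 := eps ^+ 2 / (sqnorm v + 1).
  have e10 : 0 < e1 by rewrite divr_gt0 // exprn_gt0.
  have [r r0 hr] := C1_expansion x f1 e10.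
  exists (Num.sqrt (r / (sqnorm v + 1))); first by rewrite /= sqrtr_gt0 divr_gt0.
  move=> h; rewrite /= sub0r normrN => hh h0.
  have h2 : h ^+ 2 * (sqnorm v + 1) < r.
    rewrite -ltr_pdivlMr // -real_normK ?num_real //.
    rewrite -[ltRHS]sqr_sqrtr; last by rewrite divr_ge0 // ltW.
    by rewrite ltr_pXn2r // nnegrE ?sqrtr_ge0.
  have hp : 0 < h ^+ 2 by rewrite exprn_even_gt0.
  have hr2 : sqnorm (h *: v) < r by rewrite sqnormZ; lra.
  have := hr (h *: v) hr2; rewrite innerZr -/b (addrC x) sqnormZ => hq.
  have -> : b - h^-1 *: (f (h *: v + x) - f x) = - (h^-1 * (f (h *: v + x) - f x - h * b)).
    by rewrite -[_ *: _]/(_ * _); field.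
  rewrite normrN normrM normfV.
  have hn : 0 < `|h| by rewrite normr_gt0.
  rewrite ltr_pdivrMl // -(ltr_pXn2r (ltn0Sn 1)) ?nnegrE ?mulr_ge0 //; last exact: ltW.
  rewrite exprMn !real_normK ?num_real //; apply: le_lt_trans hq _.
  rewrite mulrCA ltr_pM2l // /e1 mulrAC ltr_pdivrMr // ltr_pM2l ?exprn_gt0 //.
  by rewrite ltrDl.
split; first by apply/cvg_ex; exists b.
exact: cvg_lim.
Qed.

(** The partial derivatives of [f] are of class C^1, so the gradient itself has a
    first-order expansion, with the Hessian as derivative. *)
Lemma grad_expansion f x eps : Ck_on [set: 'rV[R]_d] 2 f -> 0 < eps ->
  exists2 r, 0 < r & forall e, sqnorm e < r ->
    sqnorm (grad f (x + e) - grad f x - e *m hess f x) <= eps * sqnorm e.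
Proof.
move=> [_ df] eps0.
have d1 : 0 < d%:R + 1 :> R by rewrite ltr_wpDl.
pose Df (j : 'I_d) := 'D_(delta_mx 0 j) f.
have Df1 j : Ck_on [set: 'rV[R]_d] 1 (Df j) by have [_] := df (delta_mx 0 j).
have : \forall e \near (0 : 'rV[R]_d), forall j,
    (Df j (x + e) - Df j x - inner (grad (Df j) x) e) ^+ 2 <= eps / (d%:R + 1) * sqnorm e.
  apply: (@filter_forall _ _ (fun j e => (Df j (x + e) - Df j x - inner (grad (Df j) x) e) ^+ 2
           <= eps / (d%:R + 1) * sqnorm e) (nbhs (0 : 'rV[R]_d))) => j.
  apply/nbhs_sqnormP; have [r r0 hr] := C1_expansion x (Df1 j) (divr_gt0 eps0 d1).
  by exists r => // e er; rewrite add0r; exact: hr.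
move=> /nbhs_sqnormP[r r0 hr]; exists r => // e er.
have {}hr := hr e er; rewrite add0r in hr.
rewrite [leLHS]/sqnorm inner_sumE.
apply: (@le_trans _ _ (\sum_(j < d) (eps / (d%:R + 1) * sqnorm e))).
  apply: ler_sum => j _; rewrite -expr2; apply: le_trans (hr j).
  rewrite !mxE le_eqVlt; apply/orP; left; apply/eqP; congr ((_ - _) ^+ 2).
  by rewrite inner_sumE; apply: eq_bigr => i _; rewrite !mxE mulrC.
rewrite sumr_const card_ord -[leLHS]mulr_natl mulrA; apply: ler_wpM2r; first exact: sqnorm_ge0.
rewrite mulrCA; apply: ler_piMr; first exact: ltW.
by rewrite ler_pdivrMr // mul1r lerDl.
Qed.

(** The derivative of the remainder along the segment is controlled by the
    expansion of the gradient. *)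
Lemma taylor2 f x eps : Ck_on [set: 'rV[R]_d] 2 f -> 0 < eps ->
  exists2 r, 0 < r & forall e, sqnorm e < r ->
    `|f (x + e) - f x - inner (grad f x) e - inner (e *m hess f x) e / 2|
      <= eps * sqnorm e.
Proof.
move=> f2 eps0; have f1 := Ck_onW f2.
have [r r0 hr] := grad_expansion x f2 (exprn_gt0 2 eps0).
exists r => // e er.
pose b := inner (grad f x) e; pose c := inner (e *m hess f x) e / 2.
pose l (t : R) := f (x + t *: e) - (t * b + t ^+ 2 * c).
pose dl (t : R) := inner (grad f (x + t *: e) - grad f x - (t *: e) *m hess f x) e.
have dlE (t : R) : is_derive t 1 l (dl t).
  have h1 : is_derive t 1 (fun s : R => f (x + s *: e)) (inner (grad f (x + t *: e)) e).
    have fd := C1_is_derive (x + t *: e) e f1.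
    by rewrite -(@derive_val _ _ _ _ _ _ _ fd); apply: line_is_derive; exact: ex_derive.
  have h2 : is_derive t 1 (fun s : R => s * b + s ^+ 2 * c) (b + 2 * t * c).
    apply: (@is_derive_of_quadratic _ _ _ _ _ _ `|c| 1) => // h _.
    rewrite -[h *: 1]/(h * 1) mulr1.
    have -> : (h + t) * b + (h + t) ^+ 2 * c - (t * b + t ^+ 2 * c) - h * (b + 2 * t * c)
       = c * h ^+ 2 by ring.
    by rewrite normrM (ger0_norm (sqr_ge0 h)).
  have -> : dl t = inner (grad f (x + t *: e)) e - (b + 2 * t * c).
    by rewrite /dl -scalemxAl !inner_lin /b /c; field.
  exact: is_deriveB.
have lc : {within `[0, 1], continuous l}.
  by apply: derivable_within_continuous => t _; have [] := dlE t.
have [t tI] := @MVT_segment _ l dl 0 1 ler01 (fun t _ => dlE t) lc.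
have -> : l 1 - l 0 = f (x + e) - f x - inner (grad f x) e - inner (e *m hess f x) e / 2.
  by rewrite /l /b /c scale1r scale0r addr0; ring.
rewrite subr0 mulr1 => ->.
have t2 : t ^+ 2 <= 1 by move: tI; rewrite in_itv /= => /andP[t0 t1]; rewrite expr_le1.
have te : sqnorm (t *: e) <= sqnorm e.
  by rewrite sqnormZ -[leRHS]mul1r ler_wpM2r ?sqnorm_ge0.
have hq := hr _ (le_lt_trans te er).
have e2 : 0 <= eps * sqnorm e by rewrite mulr_ge0 ?sqnorm_ge0 // ltW.
rewrite -(ler_pXn2r (ltn0Sn 1)) ?nnegrE // real_normK ?num_real //.
apply: le_trans (cauchy_schwarz _ _) _.
rewrite exprMn [X in _ <= _ * X]expr2 mulrA; apply: ler_wpM2r; first exact: sqnorm_ge0.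
apply: le_trans hq _; apply: ler_wpM2l => //; exact: sqr_ge0.
Qed.

(** The second difference is the increment on [[0, t]] of a difference of [f]
    along two parallel lines; the expansion of the gradient at [x] gives its
    derivative. *)
Lemma second_difference f x a b eps : Ck_on [set: 'rV[R]_d] 2 f -> 0 < eps ->
  exists2 r, 0 < r & forall t, 0 < t -> t ^+ 2 * (2 * (sqnorm a + sqnorm b)) < r ->
    `|f (x + t *: b + t *: a) - f (x + t *: a) - f (x + t *: b) + f x
      - t ^+ 2 * inner (b *m hess f x) a|
      <= eps * t ^+ 2 * (4 * (2 * (sqnorm a + sqnorm b)) + sqnorm a).
Proof.
move=> f2 eps0; have f1 := Ck_onW f2.
set n := 2 * (sqnorm a + sqnorm b).
have [r r0 hr] := grad_expansion x f2 (exprn_gt0 2 eps0).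
exists r => // t t0 tr.
pose l (s : R) := f (x + t *: b + s *: a) - f (x + s *: a).
pose dl (s : R) := inner (grad f (x + t *: b + s *: a)) a - inner (grad f (x + s *: a)) a.
have fline y (s : R) : is_derive s 1 (fun s' : R => f (y + s' *: a))
    (inner (grad f (y + s *: a)) a).
  have fd := C1_is_derive (y + s *: a) a f1.
  by rewrite -(@derive_val _ _ _ _ _ _ _ fd); apply: line_is_derive; exact: ex_derive.
have dlE (s : R) : is_derive s 1 l (dl s) by apply: is_deriveB; exact: fline.
have lc : {within `[0, t], continuous l}.
  by apply: derivable_within_continuous => s _; have [] := dlE s.
have [s sI] := @MVT_segment _ l dl 0 t (ltW t0) (fun s _ => dlE s) lc.
have -> : l t - l 0 = f (x + t *: b + t *: a) - f (x + t *: a) - f (x + t *: b) + f x.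
  by rewrite /l scale0r !addr0; ring.
rewrite subr0 => ->.
have /andP[s0 st] : 0 <= s <= t by move: sI; rewrite in_itv.
have s2 : s ^+ 2 <= t ^+ 2 by rewrite lerXn2r ?nnegrE // ltW.
have na := sqnorm_ge0 a; have nb := sqnorm_ge0 b.
have n1 : sqnorm (s *: a) <= t ^+ 2 * n.
  rewrite sqnormZ /n; have : s ^+ 2 * sqnorm a <= t ^+ 2 * sqnorm a by rewrite ler_wpM2r.
  have : 0 <= t ^+ 2 * sqnorm a by rewrite mulr_ge0 ?sqr_ge0.
  by have : 0 <= t ^+ 2 * sqnorm b; [rewrite mulr_ge0 ?sqr_ge0|lra].
have n2 : sqnorm (t *: b + s *: a) <= t ^+ 2 * n.
  apply: le_trans (sqnormD_le _ _) _; rewrite !sqnormZ /n.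
  have : s ^+ 2 * sqnorm a <= t ^+ 2 * sqnorm a by rewrite ler_wpM2r.
  by lra.
have h1 := hr _ (le_lt_trans n1 tr); have h2 := hr _ (le_lt_trans n2 tr).
set rho1 := grad f (x + s *: a) - grad f x - _ in h1.
set rho2 := grad f (x + _) - grad f x - _ in h2.
have dE : dl s = t * inner (b *m hess f x) a + inner (rho2 - rho1) a.
  rewrite /dl /rho1 /rho2 (addrA x) mulmxDl -!scalemxAl !inner_lin; ring.
have hrho : sqnorm (rho2 - rho1) <= 4 * (eps ^+ 2 * (t ^+ 2 * n)).
  apply: le_trans (sqnormD_le _ _) _; rewrite sqnormN.
  have : eps ^+ 2 * sqnorm (s *: a) <= eps ^+ 2 * (t ^+ 2 * n).
    by apply: ler_wpM2l => //; exact: sqr_ge0.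
  have : eps ^+ 2 * sqnorm (t *: b + s *: a) <= eps ^+ 2 * (t ^+ 2 * n).
    by apply: ler_wpM2l => //; exact: sqr_ge0.
  by lra.
have -> : dl s * t - t ^+ 2 * inner (b *m hess f x) a = t * inner (rho2 - rho1) a.
  by rewrite dE; ring.
have et : 0 < eps * t by rewrite mulr_gt0.
have key z : sqnorm z <= 4 * (eps ^+ 2 * (t ^+ 2 * n)) ->
    t * inner z a <= eps * t ^+ 2 * (4 * n + sqnorm a).
  move=> hz; have := @inner_young _ _ (eps * t)^-1 z a.
  rewrite invr_gt0 invrK => /(_ et) h.
  have e1 : (eps * t)^-1 * sqnorm z <= 4 * (eps * t) * n.
    rewrite ler_pdivrMl //; apply: le_trans hz _.
    by rewrite le_eqVlt; apply/orP; left; apply/eqP; ring.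
  have : 2 * inner z a <= eps * t * (4 * n + sqnorm a) by lra.
  have : 0 <= eps * t * (4 * n + sqnorm a).
    by rewrite mulr_ge0 ?(ltW et) // addr_ge0 // /n; lra.
  move=> e2 e3; have : t * inner z a <= t * (eps * t * (4 * n + sqnorm a)).
    by rewrite ler_pM2l //; lra.
  by rewrite expr2; lra.
apply/ler_normlP; split; last exact: key.
by rewrite -mulrN -innerNl; apply: key; rewrite sqnormN.
Qed.

(** The second difference is symmetric in [a] and [b]. *)
Lemma hess_sym f x : Ck_on [set: 'rV[R]_d] 2 f -> (hess f x)^T = hess f x.
Proof.
move=> f2.
have sym a b : inner (b *m hess f x) a <= inner (a *m hess f x) b.
  apply/ler_addgt0Pr => eta eta0.
  set n := 2 * (sqnorm a + sqnorm b).
  have na := sqnorm_ge0 a; have nb := sqnorm_ge0 b.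
  pose c := 8 * n + sqnorm a + sqnorm b + 1.
  have c0 : 0 < c by rewrite /c /n; lra.
  have eps0 : 0 < eta / c by rewrite divr_gt0.
  have [r1 r10 h1] := second_difference x a b f2 eps0.
  have [r2 r20 h2] := second_difference x b a f2 eps0.
  have n0 : 0 <= n by rewrite /n; lra.
  have r0 : 0 < Num.min r1 r2 by rewrite lt_min r10.
  have [t /andP[t0 _]] := exists_small_scale ltr01 n0 r0.
  rewrite lt_min => /andP[tr1 tr2].
  have {}h1 := h1 t t0 tr1.
  have {}h2 := h2 t t0; rewrite (addrC (sqnorm b)) -/n in h2; have {}h2 := h2 tr2.
  rewrite -/n in h1.
  have e1 : x + t *: a + t *: b = x + t *: b + t *: a by rewrite addrAC.
  rewrite e1 in h2; move: h1 h2.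
  set p := f (x + t *: b + t *: a); set u := f (x + t *: a); set v := f (x + t *: b).
  set al := inner _ a; set be := inner _ b.
  move=> /ler_normlP[h1 _] /ler_normlP[_ h2].
  have t2 : 0 < t ^+ 2 by rewrite exprn_gt0.
  rewrite -(ler_pM2l t2).
  have : eta / c * t ^+ 2 * c = eta * t ^+ 2 by field; rewrite gt_eqF.
  rewrite {2}/c; have : 0 < eta / c * t ^+ 2 by rewrite mulr_gt0.
  by lra.
apply/matrixP => i j; rewrite mxE.
have entry k l : hess f x k l = inner (delta_mx 0 k *m hess f x) (delta_mx 0 l).
  by rewrite inner_delta -rowE [RHS]mxE.
by rewrite !entry; apply/le_anti; rewrite !sym.
Qed.

End Taylor.

(** * Second-order expansions *)

Section SecondOrder.
Context {R : realType} {d : nat}.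
Implicit Types (f v : 'rV[R]_d -> R) (e x y g p : 'rV[R]_d) (S : 'M[R]_d).

Definition second_order_expansion f x g S := forall eps, 0 < eps ->
  exists2 r, 0 < r & forall e, sqnorm e < r ->
    `|f (x + e) - f x - inner g e - inner (e *m S) e / 2| <= eps * sqnorm e.

Definition second_order_bound f x p (N : 'rV[R]_d -> R) := forall eps, 0 < eps ->
  exists2 r, 0 < r & forall e, sqnorm e < r ->
    f (x + e) <= f x + inner p e + N e / 2 + eps * sqnorm e.

(** Comparing the two expansions at [t *: e] as [t] tends to 0 gives the slopes at
    first order and then the quadratic forms at second order. *)
Lemma expansion_le f x g S p N c : second_order_expansion f x g S ->
  second_order_bound f x p N -> (forall e, N e <= c * sqnorm e) ->
  (forall t e, N (t *: e) = t ^+ 2 * N e) ->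
  g = p /\ forall e, inner (e *m S) e <= N e.
Proof.
move=> fexp fbd Nc Nhom; split.
  have [r1 r10 h1] := fexp 1 ltr01; have [r2 r20 h2] := fbd 1 ltr01.
  apply: (@slope_unique _ _ _ _ (c / 2 + mxsum S / 2 + 2) (Num.min r1 r2)).
    by rewrite lt_min r10.
  move=> e; rewrite lt_min => /andP[e1 e2].
  have /ler_normlP[{}h1 _] := h1 e e1; have {}h2 := h2 e e2.
  by have := Nc e; have := quad_form_ge S e; lra.
move=> e; apply/ler_addgt0Pr => eta eta0.
have n1 : 0 < sqnorm e + 1 by rewrite ltr_wpDl ?sqnorm_ge0.
pose eps := eta / (4 * (sqnorm e + 1)).
have eps0 : 0 < eps by rewrite divr_gt0 // mulr_gt0.
have epsn : 4 * (eps * sqnorm e) <= eta.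
  have -> : eta = 4 * (eps * (sqnorm e + 1)) by rewrite /eps; field; rewrite gt_eqF.
  by rewrite ler_pM2l // ler_pM2l // lerDl.
have [r1 r10 h1] := fexp eps eps0; have [r2 r20 h2] := fbd eps eps0.
have gp : g = p.
  apply: (@slope_unique _ _ _ _ (c / 2 + mxsum S / 2 + 2 * eps) (Num.min r1 r2)).
    by rewrite lt_min r10.
  move=> e'; rewrite lt_min => /andP[e1 e2].
  have /ler_normlP[{}h1 _] := h1 e' e1; have {}h2 := h2 e' e2.
  by have := Nc e'; have := quad_form_ge S e'; lra.
have r0 : 0 < Num.min r1 r2 by rewrite lt_min r10.
have [t /andP[t0 _]] := exists_small_scale ltr01 (sqnorm_ge0 e) r0.
rewrite lt_min => /andP[t1 t2].
have t20 : 0 < t ^+ 2 by rewrite exprn_gt0.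
have := h1 (t *: e); rewrite sqnormZ => /(_ t1) /ler_normlP[{}h1 _].
have := h2 (t *: e); rewrite sqnormZ => /(_ t2) {}h2.
rewrite -(ler_pM2l t20); move: h1 h2; rewrite gp Nhom -scalemxAl !inner_lin.
set n := sqnorm e in epsn *; set q := inner (e *m S) e.
have : t ^+ 2 * (4 * (eps * n)) <= t ^+ 2 * eta by rewrite ler_pM2l.
by rewrite (mulrA t t) -expr2; lra.
Qed.

Lemma second_order_bound_of_expansion f x g S :
  second_order_expansion f x g S ->
  second_order_bound f x g (fun e => inner (e *m S) e).
Proof.
move=> fexp eps /fexp[r r0 hr]; exists r => // e /hr /ler_normlP[_ h].
by lra.
Qed.

Lemma quad_form_le S e : inner (e *m S) e <= mxsum S * sqnorm e.
Proof. by apply: le_trans (inner_mulmx_le _ _ _) _; lra. Qed.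

Lemma quad_formZ S t e : inner ((t *: e) *m S) (t *: e) = t ^+ 2 * inner (e *m S) e.
Proof. by rewrite -scalemxAl !inner_lin mulrA expr2. Qed.

(** Yields gradient and Hessian of a polynomial from its expression, without
    computing partial derivatives. *)
Lemma expansion_unique f x g S g' S' :
  second_order_expansion f x g S -> second_order_expansion f x g' S' ->
  g = g' /\ forall e, inner (e *m S) e = inner (e *m S') e.
Proof.
move=> h h'.
have [gE le1] := expansion_le h (second_order_bound_of_expansion h')
  (quad_form_le S') (quad_formZ S').
have [_ le2] := expansion_le h' (second_order_bound_of_expansion h)
  (quad_form_le S) (quad_formZ S).
by split=> // e; apply/le_anti; rewrite le1 le2.
Qed.

Lemma second_order_expansionN f x g S : second_order_expansion f x g S ->
  second_order_expansion (fun y => - f y) x (- g) (- S).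
Proof.
move=> h eps /h[r r0 hr]; exists r => // e /hr.
rewrite mulmxN !innerNl -normrN => h1; apply: le_trans h1.
by rewrite le_eqVlt; apply/orP; left; apply/eqP; congr `|_|; ring.
Qed.

Lemma C2_expansion f x : Ck_on [set: 'rV[R]_d] 2 f ->
  second_order_expansion f x (grad f x) (hess f x).
Proof. by move=> f2 eps; exact: taylor2. Qed.

Lemma C11_semi v : C11 v -> exists k,
  semiconvex_along v (grad v) k /\ semiconcave_along v (grad v) k.
Proof.
move=> [dv [M0 [_ hM]]].
pose K := Num.max (M0 + 1) 0.
have hK : M0 < Num.max (M0 + 1) 0 by rewrite lt_max ltrDl ltr01.
have K0 : 0 <= K by rewrite le_max lexx orbT.
have lip x y : `|grad v x - grad v y| <= K * `|x - y|.
  by have := hM _ hK (x, y); apply.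
pose k := 1 + d%:R * K ^+ 2.
have dE y e : 'D_e v y = inner (grad v y) e.
  have fd : differentiable v y by exact: dv.
  rewrite deriveE // -{1}(row_sum_coord e) linear_sum inner_sumE /=.
  by apply: eq_bigr => i _; rewrite linearZ /= mxE deriveE // mulrC.
have key y e : `|v (y + e) - v y - inner (grad v y) e| <= k / 2 * sqnorm e.
  have vd t : derivable v (y + t *: e) e by apply: diff_derivable; exact: dv.
  have [t] := line_mvt 1 vd; rewrite normr1 scale1r mul1r dE => t1 ->.
  have -> : inner (grad v (y + t *: e)) e - inner (grad v y) e
     = inner (grad v (y + t *: e) - grad v y) e by rewrite innerDl innerNl.
  set q := _ - grad v y.
  have qb : sqnorm q <= d%:R * K ^+ 2 * sqnorm e.
    apply: le_trans (sqnorm_le_norm _) _; rewrite -mulrA; apply: ler_wpM2l => //.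
    apply: le_trans (_ : (K * `|e|) ^+ 2 <= _); last first.
      by rewrite exprMn ler_wpM2l ?sqr_ge0 // norm_le_sqnorm.
    rewrite lerXn2r ?nnegrE ?mulr_ge0 //; apply: le_trans (lip _ _) _.
    apply: ler_wpM2l => //; rewrite addrAC subrr add0r normrZ.
    by rewrite ler_piMl.
  have h1 := inner_young q e ltr01; have h2 := inner_young (- q) e ltr01.
  rewrite innerNl sqnormN in h2; rewrite invr1 in h1 h2.
  by apply/ler_normlP; rewrite /k; split; lra.
by exists k; split=> y e; have /ler_normlP[h1 h2] := key y e; lra.
Qed.

Lemma convex_data_of_C2 (H : 'rV[R]_d -> R) :
  Ck_on [set: 'rV[R]_d] 2 H -> uniformly_convex H ->
  exists th Th, convex_data H (grad H) (hess H) th Th.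
Proof.
move=> H2 [Th [th [Th0 th0 Hb]]].
have Hc : continuous H by have [h _] := H2; move=> x; exact: h.
have lo p e : th * sqnorm e <= inner (e *m hess H p) e.
  by have [/(_ e) h _] := Hb p; rewrite inner_scalar_mx in h.
have hi p e : inner (e *m hess H p) e <= Th * sqnorm e.
  by have [_ /(_ e) h] := Hb p; rewrite inner_scalar_mx in h.
exists th, Th; split=> //.
- by move=> p; exact: hess_sym.
- move=> p eps eps0.
  have ent i j : continuous (fun q => hess H q i j).
    have [_ /(_ (delta_mx 0 j))[_ [_ /(_ (delta_mx 0 i))[_ [h _]]]]] := H2.
    move=> q; have := h q I.
    by have -> : (fun q => hess H q i j) = 'D_(delta_mx 0 i) ('D_(delta_mx 0 j) H)
      by apply/funext => q'; rewrite mxE.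
  have sumc : continuous (fun q => mxsum (hess H q - hess H p)).
    rewrite /mxsum; apply: continuous_big => [|i _]; first exact: add_continuous.
    apply: continuous_big => [|j _]; first exact: add_continuous.
    under eq_fun do rewrite mxE.
    move=> q; apply: (@continuous_comp _ _ _ (fun q => hess H q i j + (- hess H p) i j)
      (fun r : R => `|r|)); last exact: norm_continuous.
    by apply: continuous_atD; [exact: ent|exact: continuous_at_cst].
  have s0 : mxsum (hess H p - hess H p) < Num.sqrt eps.
    rewrite subrr /mxsum big1 ?sqrtr_gt0 // => i _.
    by rewrite big1 // => j _; rewrite mxE normr0.
  have /nbhs_sqnormP[r r0 hr] := near_lt_of_continuous (sumc p) s0.
  exists r => // q qr e; apply: le_trans (sqnorm_mulmx_le _ _) _.
  apply: ler_wpM2r; first exact: sqnorm_ge0.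
  have pq : p + (q - p) = q by rewrite addrC subrK.
  have /ltW := hr _ qr; rewrite /= pq => h.
  by rewrite -(sqr_sqrtr (ltW eps0)) lerXn2r ?nnegrE ?sqrtr_ge0 ?mxsum_ge0.
- have cN : continuous (fun x => - H x) by move=> x; apply: continuous_atN; exact: Hc.
  have h : hessian_le (fun x => - H x) (fun x => - grad H x) (fun _ e => - th * sqnorm e).
    move=> y eps /(C2_expansion y H2)[r r0 hr]; exists r => // e /hr /ler_normlP[h _].
    by rewrite innerNl; have := lo y e; lra.
  have := semiconcave_of_hessian_le cN h (fun _ e => lexx _).
  by move=> sc y e; have := sc y e; rewrite innerNl; lra.
- have h : hessian_le H (grad H) (fun _ e => Th * sqnorm e).
    move=> y eps /(C2_expansion y H2)[r r0 hr]; exists r => // e /hr /ler_normlP[_ h].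
    by have := hi y e; lra.
  exact: semiconcave_of_hessian_le Hc h (fun _ e => lexx _).
- by move=> p eps; exact: grad_expansion.
- move=> p eps /(C2_expansion p H2)[r r0 hr]; exists r => // q /hr /ler_normlP[_ h].
  by lra.
Qed.

End SecondOrder.

(** * Polynomial test functions *)

Section TestFunctions.
Context {R : realType} {d : nat}.
Implicit Types (u : 'rV[R]_d * R -> R) (v : 'rV[R]_d -> R) (z : 'rV[R]_d * R).
Implicit Types (e x g p : 'rV[R]_d) (S : 'M[R]_d).

Lemma smooth_inner_comp (V : normedModType R) (l : V -> 'rV[R]_d) p :
  continuous l -> (forall h (y y' : V), l (h *: y + y') = h *: l y + l y') ->
  smooth (fun y => inner p (l y)).
Proof.
move=> cl lin; apply: smooth_linear => [y|h y y'].
  by apply: (@continuous_comp _ _ _ l (inner p)); [exact: cl|exact: inner_continuousr].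
by rewrite lin !inner_lin.
Qed.

Lemma smooth_sqnorm_comp (V : normedModType R) (l : V -> 'rV[R]_d) (a : 'rV[R]_d) :
  continuous l -> (forall h (y y' : V), l (h *: y + y') = h *: l y + l y') ->
  smooth (fun y => sqnorm (l y - a)).
Proof.
move=> cl lin; rewrite /sqnorm; under eq_fun do rewrite inner_sumE.
apply: smooth_sum => i.
have si : smooth (fun y => (l y - a) 0 i).
  have -> : (fun y => (l y - a) 0 i) = (fun y => inner (delta_mx 0 i) (l y) + - a 0 i).
    by apply/funext => y; rewrite innerC inner_delta !mxE.
  by apply: smoothD; [exact: smooth_inner_comp|exact: smooth_cst].
exact: smoothM.
Qed.

Definition paraboloid z p (b L : R) (z' : 'rV[R]_d * R) : R :=
  inner p (z'.1 - z.1) + b * (z'.2 - z.2)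
  + L * (sqnorm (z'.1 - z.1) + (z'.2 - z.2) ^+ 2).

Lemma smooth_paraboloid z p b L : smooth (paraboloid z p b L).
Proof.
have c1 : continuous (fst : 'rV[R]_d * R -> 'rV[R]_d) by move=> y; exact: cvg_fst.
have s2 : smooth (fun y : 'rV[R]_d * R => y.2 - z.2).
  apply: smoothD; last exact: smooth_cst.
  by apply: smooth_linear => // y; exact: cvg_snd.
have s1 : smooth (fun y : 'rV[R]_d * R => inner p (y.1 - z.1)).
  under eq_fun do rewrite innerDr.
  by apply: smoothD; [exact: smooth_inner_comp|exact: smooth_cst].
apply: smoothD.
  by apply: smoothD => //; apply: smoothM => //; exact: smooth_cst.
apply: smoothM; first exact: smooth_cst.
by apply: smoothD; [exact: smooth_sqnorm_comp|exact: smoothM].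
Qed.

Lemma paraboloid_time_derivative z p b L :
  time_derivative (paraboloid z p b L) z = b.
Proof.
rewrite /time_derivative derive1E.
suff : is_derive (z.2 : R) 1 (fun t : R => paraboloid z p b L (z.1, t)) b by case.
apply: (@is_derive_of_quadratic _ _ _ _ _ _ `|L| 1) => // h _.
rewrite -[h *: 1]/(h * 1) mulr1 /paraboloid /= !subrr inner0r sqnorm0 addrK.
have -> : 0 + b * h + L * (0 + h ^+ 2) - (0 + b * 0 + L * (0 + 0 ^+ 2)) - h * b
  = L * h ^+ 2 by ring.
by rewrite normrM (ger0_norm (sqr_ge0 h)).
Qed.

Lemma paraboloid_space_grad z p b L : space_grad (paraboloid z p b L) z = p.
Proof.
apply/rowP => i; rewrite mxE.
suff : is_derive z.1 (delta_mx 0 i) (fun x => paraboloid z p b L (x, z.2)) (p 0 i) by case.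
apply: (@is_derive_of_quadratic _ _ _ _ _ _ `|L| 1) => // h _.
rewrite /paraboloid /= !subrr inner0r sqnorm0 addrK innerZr inner_delta sqnormZ.
have -> : sqnorm (delta_mx 0 i : 'rV[R]_d) = 1.
  by rewrite /sqnorm inner_delta mxE !eqxx.
set q := p 0 i.
have -> : h * q + b * 0 + L * (h ^+ 2 * 1 + 0 ^+ 2) - (0 + b * 0 + L * (0 + 0 ^+ 2)) - h * q
  = L * h ^+ 2 by ring.
by rewrite normrM (ger0_norm (sqr_ge0 h)).
Qed.

Lemma paraboloid_center z p b L : paraboloid z p b L z = 0.
Proof. by rewrite /paraboloid !subrr inner0r sqnorm0 expr0n /=; ring. Qed.

Lemma paraboloid_subsolution_of_viscosity Ham u :
  viscosity_subsolution Ham u -> paraboloid_subsolution Ham u.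
Proof.
move=> visc z z0 p b L touch.
have Ck1 : Ck_on open_half_space 1 (paraboloid z p b L).
  by apply: Ck_on_subset (smooth_paraboloid z p b L 1).
have := visc _ Ck1 z z0; rewrite paraboloid_time_derivative paraboloid_space_grad.
apply; apply: filterS touch => w; rewrite paraboloid_center /paraboloid; lra.
Qed.

Lemma paraboloid_subsolution_opp Ham u :
  viscosity_supersolution Ham u ->
  paraboloid_subsolution (fun p => - Ham (- p)) (fun z => - u z).
Proof.
move=> visc z z0 p b L touch.
have Ck1 : Ck_on open_half_space 1 (paraboloid z (- p) (- b) (- L)).
  by apply: Ck_on_subset (smooth_paraboloid z (- p) (- b) (- L) 1).
have := visc _ Ck1 z z0; rewrite paraboloid_time_derivative paraboloid_space_grad.
rewrite lerNr; apply; apply: filterS touch => w.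
by rewrite paraboloid_center /paraboloid innerNl; lra.
Qed.

(** The quartic term leaves the second-order expansion at [x0] unchanged and makes
    the contact global when the paraboloid touches only locally. *)
Definition quartic x0 (c : R) g S (M : R) x : R :=
  c + inner g (x - x0) + inner ((x - x0) *m S) (x - x0) / 2 - M * sqnorm (x - x0) ^+ 2.

Lemma smooth_quartic x0 c g S M : smooth (quartic x0 c g S M).
Proof.
have cid : continuous (id : 'rV[R]_d -> 'rV[R]_d) by move=> y.
have si p : smooth (fun x => inner p (x - x0)).
  under eq_fun do rewrite innerDr.
  by apply: smoothD; [exact: smooth_inner_comp|exact: smooth_cst].
have sq : smooth (fun x => sqnorm (x - x0)) by exact: smooth_sqnorm_comp.
have sS : smooth (fun x => inner ((x - x0) *m S) (x - x0)).
  under eq_fun do rewrite inner_quad_sumE.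
  have sc i : smooth (fun x => (x - x0) 0 i).
    by under eq_fun do rewrite -inner_delta innerC; exact: si.
  apply: smooth_sum => i; apply: smooth_sum => j.
  by apply: smoothM => //; apply: smoothM => //; exact: smooth_cst.
apply: smoothD.
  apply: smoothD; first by apply: smoothD => //; exact: smooth_cst.
  by apply: smoothM => //; exact: smooth_cst.
have -> : (fun x => - (M * sqnorm (x - x0) ^+ 2))
   = (fun x => (- M) * (sqnorm (x - x0) * sqnorm (x - x0))).
  by apply/funext => x; rewrite mulNr expr2.
by apply: smoothM; [exact: smooth_cst|exact: smoothM].
Qed.

Lemma quartic_expansion x0 c g S M :
  second_order_expansion (quartic x0 c g S M) x0 g S.
Proof.
move=> eps eps0; have M1 : 0 < `|M| + 1 by rewrite ltr_wpDl.
exists (eps / (`|M| + 1)); first by rewrite divr_gt0.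
move=> e; rewrite ltr_pdivlMr // => er.
have ee : x0 + e - x0 = e by rewrite addrAC subrr add0r.
rewrite /quartic ee subrr mul0mx !inner0r sqnorm0.
have -> : c + inner g e + inner (e *m S) e / 2 - M * sqnorm e ^+ 2
   - (c + 0 + 0 / 2 - M * 0 ^+ 2) - inner g e - inner (e *m S) e / 2
   = - (M * sqnorm e ^+ 2) by ring.
have n0 := sqnorm_ge0 e.
rewrite normrN normrM (ger0_norm (sqr_ge0 (sqnorm e))) expr2 mulrA.
apply: ler_wpM2r => //; move: er; rewrite mulrDr mulr1 mulrC; lra.
Qed.

Lemma quartic_grad x0 c g S M : grad (quartic x0 c g S M) x0 = g.
Proof.
have := C2_expansion x0 (smooth_quartic x0 c g S M 2).
by move=> /expansion_unique /(_ (quartic_expansion x0 c g S M))[].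
Qed.

Lemma quartic_hess x0 c g S M e :
  inner (e *m hess (quartic x0 c g S M) x0) e = inner (e *m S) e.
Proof.
have := C2_expansion x0 (smooth_quartic x0 c g S M 2).
by move=> /expansion_unique /(_ (quartic_expansion x0 c g S M))[].
Qed.

Lemma quartic_center x0 c g S M : quartic x0 c g S M x0 = c.
Proof. by rewrite /quartic subrr mul0mx !inner0r sqnorm0 expr0n /=; ring. Qed.

End TestFunctions.

(** * The viscosity inequality in terms of the inverse Hessian form *)

Section ViscosityForm.
Context {R : realType} {d : nat}.
Implicit Types (v : 'rV[R]_d -> R) (e x y g p w : 'rV[R]_d) (S : 'M[R]_d).
Implicit Types (F A : 'rV[R]_d -> 'M[R]_d).

(** The common content of the two viscosity inequalities of the statement: the
    second one for [v] is this property for [- v] and the reflected [F]. *)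
Definition quartic_touching F v (K : R) := forall x0 g S M,
  (forall e, v x0 + inner g e + inner (e *m S) e / 2 - M * sqnorm e ^+ 2 <= v (x0 + e)) ->
  forall w, inner (w *m F g *m S) (w *m F g) <= K * sqnorm w.

Lemma quartic_touching_of_viscosity_ge F v K :
  (forall p, (F p)^T = F p) -> viscosity_ge F v K -> quartic_touching F v K.
Proof.
move=> Fs visc x0 g S M touch w.
have gmin x : v x0 - quartic x0 (v x0) g S M x0 <= v x - quartic x0 (v x0) g S M x.
  have := touch (x - x0); have -> : x0 + (x - x0) = x by rewrite addrC subrK.
  by rewrite quartic_center /quartic; lra.
have := visc _ (smooth_quartic x0 (v x0) g S M) x0 gmin w.
rewrite quartic_grad inner_scalar_mx mulmxN innerNl !mulmxA (inner_mulmx _ (F g)) Fs.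
by rewrite quartic_hess -/(sqnorm w); lra.
Qed.

Lemma quartic_touching_of_viscosity_le F v K :
  (forall p, (F p)^T = F p) -> viscosity_le F v K ->
  quartic_touching (fun p => F (- p)) (fun x => - v x) K.
Proof.
move=> Fs visc x0 g S M touch w.
have gmax x : v x - quartic x0 (v x0) (- g) (- S) (- M) x
    <= v x0 - quartic x0 (v x0) (- g) (- S) (- M) x0.
  have := touch (x - x0); have -> : x0 + (x - x0) = x by rewrite addrC subrK.
  by rewrite quartic_center /quartic mulmxN !innerNl; lra.
have := visc _ (smooth_quartic x0 (v x0) (- g) (- S) (- M)) x0 gmax w.
rewrite quartic_grad inner_scalar_mx mulmxN innerNl !mulmxA (inner_mulmx _ (F (- g))) Fs.
by rewrite quartic_hess -/(sqnorm w) mulmxN innerNl; lra.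
Qed.

Section SquareRoot.
Variables (H : 'rV[R]_d -> R) (DH : 'rV[R]_d -> 'rV[R]_d).
Variables (A F : 'rV[R]_d -> 'M[R]_d) (th Th : R).
Hypothesis HA : convex_data H DH A th Th.
Hypothesis Fs : forall p, (F p)^T = F p.
Hypothesis FF : forall p, F p *m F p = A p.

Lemma sqrt_unitmx p : F p \in unitmx.
Proof. by have := cd_unitmx HA p; rewrite -FF unitmx_mul andbb. Qed.

Lemma inv_form_sqrt p w : inv_form A p (w *m F p) = sqnorm w.
Proof.
rewrite /inv_form -FF.
have -> : invmx (F p *m F p) = invmx (F p) *m invmx (F p).
  have u : F p *m F p \in unitmx by rewrite unitmx_mul sqrt_unitmx.
  apply: (can_inj (mulKmx u)); rewrite mulmxV //.
  by rewrite mulmxA mulmxK ?sqrt_unitmx // mulmxV ?sqrt_unitmx.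
by rewrite mulmxA mulmxK ?sqrt_unitmx // innerC (inner_mulmx w) Fs mulmxKV ?sqrt_unitmx.
Qed.

Lemma form_le_inv_formP p S K :
  (forall w, inner (w *m F p *m S) (w *m F p) <= K * sqnorm w) <->
  (forall e, inner (e *m S) e <= K * inv_form A p e).
Proof.
split=> h e; last by rewrite -(inv_form_sqrt p).
have eE : e = e *m invmx (F p) *m F p by rewrite mulmxKV ?sqrt_unitmx.
by rewrite {1 2 3}eE inv_form_sqrt.
Qed.

Lemma touching_le_of_quartic v G k K :
  semiconvex_along v G k -> semiconcave_along v G k ->
  quartic_touching F v K -> touching_le v (fun p e => K * inv_form A p e).
Proof.
move=> vcx vcv quart x g S r r0 touch.
have gE := slope_of_touching r0 vcv touch.
apply/form_le_inv_formP.
(* Outside the ball of squared radius [r] the quartic term dominates both the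
   quadratic form [S] and the semiconvexity defect of [v]. *)
pose M := (`|k| / 2 + mxsum S / 2) / r.
have Mr : M * r = `|k| / 2 + mxsum S / 2 by rewrite /M divfK // gt_eqF.
have M0 : 0 <= M.
  by rewrite divr_ge0 ?(ltW r0) // addr_ge0 // divr_ge0 // mxsum_ge0.
apply: (quart x g S M) => e; have n0 := sqnorm_ge0 e.
have [er|er] := ltP (sqnorm e) r.
  have := touch e er; have : 0 <= M * sqnorm e ^+ 2 by rewrite mulr_ge0 ?sqr_ge0.
  by lra.
have := vcx x e; have := quad_form_le S e; rewrite gE.
have : M * r * sqnorm e <= M * sqnorm e ^+ 2.
  by rewrite -mulrA ler_wpM2l // expr2 ler_wpM2r.
have : k * sqnorm e <= `|k| * sqnorm e by rewrite ler_wpM2r // ler_norm.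
by rewrite Mr; lra.
Qed.

Lemma inv_formZ p t e : inv_form A p (t *: e) = t ^+ 2 * inv_form A p e.
Proof. by rewrite /inv_form quad_formZ. Qed.

(** Here [f] is a test function, or its opposite, that touches [v] from below at
    [x]. *)
Lemma form_le_of_hessian_le v G K f x g S : 0 < K ->
  hessian_le v G (fun p e => K * inv_form A p e) ->
  second_order_expansion f x g S ->
  (forall y, f y - f x <= v y - v x) ->
  forall w, inner (w *m F g *m S) (w *m F g) <= K * sqnorm w.
Proof.
move=> K0 vhess fexp fv.
have fb : second_order_bound f x (G x) (fun e => K * inv_form A (G x) e).
  move=> eps /(vhess x)[r r0 hr]; exists r => // e /hr.
  by have := fv (x + e); lra.
have [|t e|-> le1] := @expansion_le _ _ f x g S (G x) _ (K * th^-1) fexp fb.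
- by move=> e; rewrite -mulrA ler_pM2l //; exact: inv_form_le HA _ e.
- by rewrite inv_formZ; ring.
exact/form_le_inv_formP.
Qed.

End SquareRoot.
End ViscosityForm.

(** * The symmetric positive definite square root *)

Section SquareRoot.
Context {R : realType} {d : nat}.
Implicit Types A : 'M[R]_d.

(** The complex spectral theorem applies to the Hermitian matrix [A]; since [A] and
    its eigenvalues are real, the similarity can be taken real. *)
Lemma real_diagonalization A : A^T = A ->
  exists (Q : 'M[R]_d) (D : 'rV[R]_d), Q \in unitmx /\ Q *m A = diag_mx D *m Q.
Proof.
move=> As; pose toC := real_complex R.
have back m n (B : 'M[R[i]]_(m, n)) : B \is a mxOver Num.real ->
    map_mx toC (map_mx (@complex.Re R) B) = B.
  move=> /mxOverP Br; apply/matrixP => i j; rewrite !mxE; exact: RRe_real.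
pose A' := map_mx toC A.
have A'real : A' \is a mxOver Num.real.
  by apply/mxOverP => i j; rewrite mxE complex_real.
have A'sym : A' \is symmetricmx.
  by apply/is_hermitianmxP; rewrite expr0 scale1r map_mx_id // map_trmx As.
have A'herm := realsym_hermsym A'sym A'real.
have /orthomx_spectralP A'E := hermitian_normalmx A'herm.
have Dreal := hermitian_spectral_diag_real A'herm.
set D' := spectral_diag A' in A'E Dreal.
have P'unit := spectral_unit A'; set P' := spectralmx A' in A'E P'unit.
have sim : similar_in unitmx A' (diag_mx D').
  exists P' => //; apply/similarP => //.
  by rewrite {1}A'E !mulmxA mulmxV // mul1mx.
have D'real : diag_mx D' \is a mxOver Num.real.
  apply/mxOverP => i j; rewrite mxE; apply: rpredMn.
  by move/mxOverP: Dreal; apply.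
have [Q' /andP[Q'real Q'unit] /(similarP Q'unit) QA] := real_similar sim A'real D'real.
exists (map_mx (@complex.Re R) Q'), (map_mx (@complex.Re R) D').
have Q'E := back _ _ _ Q'real; have D'E := back _ _ _ Dreal.
set Q := map_mx _ Q' in Q'E *; set D := map_mx _ D' in D'E *.
split; first by rewrite -(map_unitmx toC) Q'E.
apply: (@map_mx_inj _ _ toC); rewrite !map_mxM map_diag_mx Q'E D'E -/A'.
exact: QA.
Qed.

(** A diagonal fourth root conjugated back by Q is symmetric because [Q *m Q^T]
    commutes with the diagonal matrix, hence with its fourth root; its square is
    then positive definite for free. *)
Lemma posdef_sqrt A (th : R) : A^T = A -> 0 < th ->
  (forall e, th * sqnorm e <= inner (e *m A) e) ->
  exists B, symmetric_posdef B /\ B *m B = A.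
Proof.
move=> As th0 Ath; have [Q [D [Qu QA]]] := real_diagonalization As.
have D0 i : 0 <= D 0 i.
  have qi : row i Q *m A = D 0 i *: row i Q.
    by rewrite -row_mul QA row_mul row_diag_mx -scalemxAl -rowE.
  have q0 : 0 < sqnorm (row i Q).
    rewrite sqnorm_gt0; apply/negP => /eqP r0.
    have := mulmxV Qu => /(congr1 (row i)); rewrite row_mul r0 mul0mx.
    move=> /rowP /(_ i); rewrite !mxE eqxx => /eqP.
    by rewrite eq_sym oner_eq0.
  rewrite -(pmulr_lge0 _ q0) -innerZl -qi; apply: le_trans (Ath _).
  by rewrite mulr_ge0 ?sqnorm_ge0 // ltW.
pose W := Q *m Q^T.
have Wsym : W^T = W by rewrite /W trmx_mul trmxK.
have DW : diag_mx D *m W = W *m diag_mx D.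
  have : (diag_mx D *m W)^T = diag_mx D *m W.
    by rewrite /W !mulmxA -QA !trmx_mul trmxK As mulmxA.
  by rewrite trmx_mul Wsym tr_diag_mx.
pose r i := Num.sqrt (Num.sqrt (D 0 i)).
pose r4 : 'M[R]_d := diag_mx (\row_i r i).
have rW : r4 *m W = W *m r4.
  apply/matrixP => i j; rewrite /r4 mul_diag_mx mul_mx_diag !mxE.
  have := DW => /matrixP /(_ i j); rewrite mul_diag_mx mul_mx_diag !mxE.
  set w := \sum_k _; have [->|w0] := eqVneq w 0; first by rewrite !(mulr0, mul0r).
  by rewrite (mulrC w) => /(mulIf w0); rewrite /r => ->; rewrite mulrC.
have r44 : r4 *m r4 *m (r4 *m r4) = diag_mx D.
  rewrite /r4 !mulmx_diag; congr diag_mx; apply/rowP => i; rewrite !mxE.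
  by rewrite /r -!expr2 !sqr_sqrtr ?sqrtr_ge0.
pose E := invmx Q *m r4 *m Q.
have EE X Y : (invmx Q *m X *m Q) *m (invmx Q *m Y *m Q) = invmx Q *m (X *m Y) *m Q.
  by rewrite -!mulmxA (mulKVmx Qu).
have Esym : E^T = E.
  have QT : Q^T \in unitmx by rewrite unitmx_tr.
  apply: (can_inj (mulKmx Qu)); apply: (can_inj (mulmxK QT)).
  rewrite /E !trmx_mul tr_diag_mx trmx_inv.
  have -> : Q *m (Q^T *m (r4 *m invmx Q^T)) *m Q^T = W *m r4.
    by rewrite /W -!mulmxA mulVmx // mulmx1.
  rewrite -!mulmxA mulKVmx // mulmxA; exact: esym rW.
pose B := E *m E.
have BB : B *m B = A.
  by rewrite /B /E !EE r44 -!mulmxA -QA mulKmx.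
have Bsym : B^T = B by rewrite /B trmx_mul Esym.
exists B; split=> //; split=> // v v0.
have -> : inner (v *m B) v = sqnorm (v *m E).
  by rewrite /B mulmxA inner_mulmx Esym.
rewrite sqnorm_gt0; apply/negP => /eqP vE.
have := Ath v; rewrite -BB /B (mulmxA v (E *m E)) (mulmxA v E) vE !mul0mx inner0l leNgt.
by rewrite mulr_gt0 ?sqnorm_gt0.
Qed.

Lemma sqrtmxP A (th : R) : A^T = A -> 0 < th ->
  (forall e, th * sqnorm e <= inner (e *m A) e) ->
  (sqrtmx A)^T = sqrtmx A /\ sqrtmx A *m sqrtmx A = A.
Proof.
move=> As th0 Ath; have [B hB] := posdef_sqrt As th0 Ath.
have : [set B | symmetric_posdef B /\ B *m B = A] (sqrtmx A).
  by apply: getPex; exists B.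
by move=> [[? _] ?].
Qed.

End SquareRoot.

(** * Bounded uniformly continuous data, and the theorem *)

Lemma unif_continuous_continuous (U V : uniformType) (f : U -> V) :
  unif_continuous f -> continuous f.
Proof.
move=> uc x B; rewrite -nbhs_entourageE => -[E eE EB].
have := nbhs_entourage x (uc E eE); apply: filterS => y /xsectionP Exy.
by apply: EB; apply/xsectionP.
Qed.

Section Data.
Context {R : realType} {d : nat}.

Lemma BUC_on_bounded (u : 'rV[R]_d * R -> R) :
  BUC_on closed_half_space u -> exists M, forall z, closed_half_space z -> `|u z| <= M.
Proof.
move=> [[M0 [_ hM]] _]; exists (M0 + 1) => z zh.
by apply: hM => //; rewrite ltrDl ltr01.
Qed.

Lemma BUC_on_continuous (u : 'rV[R]_d * R -> R) :
  BUC_on closed_half_space u -> {within closed_half_space, continuous u}.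
Proof. by move=> [_ uc]; exact: unif_continuous_continuous. Qed.

(** Both parts of the theorem at once: the second one is the first one for
    [- u] and the reflected Hamiltonian. *)
Lemma quartic_touching_propagates (H : 'rV[R]_d -> R) (DH : 'rV[R]_d -> 'rV[R]_d)
    (A F : 'rV[R]_d -> 'M[R]_d) (th Th : R) (u : 'rV[R]_d * R -> R)
    (G0 : 'rV[R]_d -> 'rV[R]_d) (k M C t : R) :
  convex_data H DH A th Th ->
  (forall p, (F p)^T = F p) -> (forall p, F p *m F p = A p) ->
  (forall z, closed_half_space z -> `|u z| <= M) ->
  {within closed_half_space, continuous u} ->
  paraboloid_subsolution H u ->
  paraboloid_subsolution (fun p => - H (- p)) (fun z => - u z) ->
  semiconvex_along (fun x => u (x, 0)) G0 k ->
  semiconcave_along (fun x => u (x, 0)) G0 k ->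
  quartic_touching F (fun x => u (x, 0)) C ->
  0 < C -> 0 < t -> 0 < 1 - C * t ->
  forall f x g S, second_order_expansion f x g S ->
    (forall y, f y - f x <= u (y, t) - u (x, t)) ->
    forall w, inner (w *m F g *m S) (w *m F g) <= C / (1 - C * t) * sqnorm w.
Proof.
move=> HA Fs FF uM uc usub usup vcx vcv quart C0 t0 Ct f x g S fexp fu.
pose k' := `|k| + 1.
have k'0 : 0 < k' by rewrite ltr_wpDl.
have kk' : k <= k' by rewrite /k'; have := ler_norm k; lra.
have {}vcx := semiconvex_alongW kk' vcx; have {}vcv := semiconcave_alongW kk' vcv.
have vc := slice_continuous (lexx 0) uc.
have vtouch := touching_le_of_quartic HA Fs FF vcx vcv quart.
have vhess := hessian_le_of_touching k'0 vc vcx vcv (inv_form_usc HA C0) vtouch.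
have [G [kt [_ Gt]]] :=
  inverse_hessian_bound_propagates HA uM uc usub usup vcx vhess C0 t0 Ct.
by have := form_le_of_hessian_le HA Fs FF (divr_gt0 C0 Ct) Gt fexp fu.
Qed.

End Data.

Theorem theorem1p3 (R : realType) (d : nat) (hd : (1 < d)%N)
    (H : 'rV[R]_d -> R) (HC2 : Ck_on [set: 'rV[R]_d] 2 H)
    (Hconv : uniformly_convex H) (Hnq : ~ quadratic H)
    (C : R) (hC : 0 < C) :
  let F := fun p : 'rV[R]_d => sqrtmx (hess H p) in
  (forall u : 'rV[R]_d * R -> R,
     BUC_on closed_half_space u ->
     viscosity_solution H u ->
     C11 (fun x => u (x, 0)) ->
     viscosity_ge F (fun x => u (x, 0)) C ->
     forall t : R, 0 < t -> 0 < Num.max (1 - C * t) 0 ->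
       viscosity_ge F (fun x => u (x, t)) (C / Num.max (1 - C * t) 0))
  /\
  (forall u : 'rV[R]_d * R -> R,
     BUC_on closed_half_space u ->
     viscosity_solution (fun p => - H p) u ->
     C11 (fun x => u (x, 0)) ->
     viscosity_le F (fun x => u (x, 0)) C ->
     forall t : R, 0 < t -> 0 < Num.max (1 - C * t) 0 ->
       viscosity_le F (fun x => u (x, t)) (C / Num.max (1 - C * t) 0)).
Proof.
have [th [Th HA]] := convex_data_of_C2 HC2 Hconv.
have sqrtP p := sqrtmxP (cd_sym HA p) (cd_lower_gt0 HA) (cd_elliptic HA p).
move=> F.
have Fs p : (F p)^T = F p by have [] := sqrtP p.
have FF p : F p *m F p = hess H p by have [] := sqrtP p.
have maxE t : 0 < Num.max (1 - C * t) 0 ->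
    Num.max (1 - C * t) 0 = 1 - C * t /\ 0 < 1 - C * t.
  by rewrite lt_max ltxx orbF => h; split=> //; rewrite max_l // ltW.
split=> u uB uvisc u0 ubd t t0 /maxE[-> Ct] phi sphi x xext w.
- have [_ usub usup] := uvisc.
  have [M uM] := BUC_on_bounded uB.
  have [k [vcx vcv]] := C11_semi u0.
  have phix y : phi y - phi x <= u (y, t) - u (x, t) by have := xext y; lra.
  have := quartic_touching_propagates HA Fs FF uM (BUC_on_continuous uB)
    (paraboloid_subsolution_of_viscosity usub) (paraboloid_subsolution_opp usup)
    vcx vcv (quartic_touching_of_viscosity_ge Fs ubd) hC t0 Ct
    (C2_expansion x (sphi 2)) phix w.
  rewrite inner_scalar_mx mulmxN innerNl !mulmxA (inner_mulmx _ (F _)) Fs.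
  by rewrite -/(sqnorm w); lra.
- have [_ usub usup] := uvisc.
  have [M uM] := BUC_on_bounded uB.
  have [k [vcx vcv]] := C11_semi u0.
  have uM' z : closed_half_space z -> `|- u z| <= M by rewrite normrN; exact: uM.
  have uc' : {within closed_half_space, continuous (fun z => - u z)}.
    by move=> z; apply: continuous_atN; exact: BUC_on_continuous.
  have phix y : - phi y - - phi x <= - u (y, t) - - u (x, t) by have := xext y; lra.
  have usub' : paraboloid_subsolution (fun p => H (- p)) (fun z => - u z).
    move=> z z0 p b L touch; have := paraboloid_subsolution_opp usup z0 touch.
    by rewrite opprK.
  have usup' : paraboloid_subsolution (fun p => - H (- - p)) (fun z => - - u z).
    move=> z z0 p b L touch; rewrite opprK.
    apply: (paraboloid_subsolution_of_viscosity usub z0 (L := L)).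
    by apply: filterS touch => z'; rewrite !opprK.
  have vcx' : semiconvex_along (fun x => - u (x, 0)) (fun x => - grad (fun x => u (x, 0)) x) k.
    by move=> y e; have := vcv y e; rewrite innerNl; lra.
  have vcv' : semiconcave_along (fun x => - u (x, 0)) (fun x => - grad (fun x => u (x, 0)) x) k.
    by move=> y e; have := vcx y e; rewrite innerNl; lra.
  have := quartic_touching_propagates (convex_data_opp HA) (fun p => Fs (- p))
    (fun p => FF (- p)) uM' uc' usub' usup' vcx' vcv'
    (quartic_touching_of_viscosity_le Fs ubd) hC t0 Ct
    (second_order_expansionN (C2_expansion x (sphi 2))) phix w.
  rewrite opprK inner_scalar_mx !mulmxN !innerNl !mulmxA (inner_mulmx _ (F _)) Fs.
  by rewrite -/(sqnorm w); lra.
Qed.
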